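(* Let $\Omega\subset\mathbb{R}^3$ be a convex polyhedron, $\mu>0$, $q\in[2,\infty)$, $\omega\in A_{q/2}$, and $\mathbf{f}\in\mathbf{L}^2(\Omega)+\mathbf{L}^{q'}(\omega',\Omega)$ (matrix valued). Set $\mathbb{S}(x,\mathbf{Q}^s)=2\left(\mu+\omega(x)|\mathbf{Q}^s|^{q-2}\right)\mathbf{Q}^s$. Let $(\mathbf{u},\mathsf{p})\in\mathbf{X}_q(\omega)\times M_q(\omega)$ be a solution of $$\int_\Omega\mathbb{S}(x,\boldsymbol{\varepsilon}(\mathbf{u})):\boldsymbol{\varepsilon}(\mathbf{v})\,dx-\int_\Omega\mathsf{p}\operatorname{div}\mathbf{v}\,dx=\int_\Omega\mathbf{f}:\nabla\mathbf{v}\,dx\ \ \forall\mathbf{v}\in\mathbf{X}_q(\omega),\qquad\int_\Omega\operatorname{div}\mathbf{u}\,r\,dx=0\ \ \forall r\in M_q(\omega),$$ and let $(\mathbf{u}_h,\mathsf{p}_h)\in\mathbf{X}_h\times M_h$ be a solution of $$\int_\Omega\mathbb{S}(x,\boldsymbol{\varepsilon}(\mathbf{u}_h)):\boldsymbol{\varepsilon}(\mathbf{v}_h)\,dx-\int_\Omega\mathsf{p}_h\operatorname{div}\mathbf{v}_h\,dx=\int_\Omega\mathbf{f}:\nabla\mathbf{v}_h\,dx\ \ \forall\mathbf{v}_h\in\mathbf{X}_h,\qquad\int_\Omega\operatorname{div}\mathbf{u}_h\,r_h\,dx=0\ \ \forall r_h\in M_h.$$ Let $(\mathbf{U}_h,P_h)\in\mathbf{X}_h\times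 M_h$ be the Stokes projection of $(\mathbf{u},\mathsf{p})$. Then $$\|\boldsymbol{\varepsilon}(\mathbf{u}-\mathbf{u}_h)\|_{\mathbf{L}^2(\Omega)}^2+\|\boldsymbol{\varepsilon}(\mathbf{u}-\mathbf{u}_h)\|_{\mathbf{L}^q(\omega,\Omega)}^q\le C\left(\|\boldsymbol{\varepsilon}(\mathbf{u}-\mathbf{U}_h)\|_{\mathbf{L}^2(\Omega)}^2+\|\boldsymbol{\varepsilon}(\mathbf{u}-\mathbf{U}_h)\|_{\mathbf{L}^q(\omega,\Omega)}^{q/(q-1)}\right),$$ where the constant $C$ (which may depend on the problem data, such as $\mathbf{f}$) is independent of $\mathbf{u}$, $\mathsf{p}$, $h$, and $(\mathbf{U}_h,P_h)$.
   Context: Muckenhoupt weights. A weight is an a.e. positive function in $L^1_{\rm loc}(\mathbb{R}^3)$. For $q\in(1,\infty)$, $\omega\in A_q$ if $[\omega]_{A_q}=\sup_B\left(\frac1{|B|}\int_B\omega\,dx\right)\left(\frac1{|B|}\int_B\omega^{1/(1-q)}dx\right)^{q-1}<\infty$; $\omega\in A_1$ if $[\omega]_{A_1}=\sup_B\left(\frac1{|B|}\int_B\omega\,dx\right)\sup_{x\in B}\frac1{\omega(x)}<\infty$; suprema over all balls $B\subset\mathbb{R}^3$. $q'$ is the Hölder conjugate of $q$ and $\omega'=\omega^{1/(1-q)}$. $L^q(\omega,\Omega)$ is the $L^q$ space with respect to $\omega\,dx$, $\mathring{L}^q(\omega,\Omega)$ its zero-average subspace, $\mathbf{W}^{1,q}_0(\omega,\Omega)$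 the corresponding weighted Sobolev space with zero trace. Boldface denotes vector or tensor valued objects; $\boldsymbol{\varepsilon}(\mathbf{v})=\frac12(\nabla\mathbf{v}+\nabla\mathbf{v}^\intercal)$. The spaces are $\mathbf{X}_q(\omega)=\mathbf{W}^{1,2}_0(\Omega)\cap\mathbf{W}^{1,q}_0(\omega,\Omega)$ and $M_q(\omega)=\mathring{L}^2(\Omega)+\mathring{L}^{q'}(\omega',\Omega)$. Finite elements. For every $h>0$, $\mathscr{T}_h$ is a quasiuniform triangulation of $\Omega$ of size $h$ and $\mathbf{X}_h\subset\mathbf{W}^{1,\infty}_0(\Omega)$, $M_h\subset L^\infty(\Omega)\cap\mathring{L}^2(\Omega)$ are finite dimensional spaces of piecewise polynomials (of fixed degree) over $\mathscr{T}_h$. All constants below are independent of $h$. For every $q\in(1,\infty)$ and $\omega\in A_q$ they satisfy $$\|p_h\|_{L^{q'}(\omega',\Omega)}\lesssim\sup_{\mathbf{0}\ne\mathbf{v}_h\in\mathbf{X}_h}\frac{\int_\Omega p_h\operatorname{div}\mathbf{v}_h\,dx}{\|\nabla\mathbf{v}_h\|_{\mathbf{L}^q(\omega,\Omega)}}\quad\forall p_h\in M_h .$$ They have the usual approximation properties over quasiuniform meshes, and there is a stable operator $\mathcal{I}_h:\mathbf{L}^1(\Omega)\to\mathbf{X}_h$ that is the identity on $\mathbf{X}_h$ and satisfies $\|\mathbf{v}-\mathcal{I}_h\mathbf{v}\|_{\mathbf{L}^\infty(\Omega)}\lesssim h^{1/2}\|\mathbf{v}\|_{\mathbf{W}^{2,2}(\Omega)}$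 for $\mathbf{v}\in\mathbf{W}^{1,2}_0(\Omega)\cap\mathbf{W}^{2,2}(\Omega)$, and, for $q\in(1,\infty)$, $\omega\in A_q$, $\|\nabla(\mathbf{v}-\mathcal{I}_h\mathbf{v})\|_{\mathbf{L}^q(\omega,\Omega)}\lesssim\inf_{\mathbf{v}_h\in\mathbf{X}_h}\|\nabla(\mathbf{v}-\mathbf{v}_h)\|_{\mathbf{L}^q(\omega,\Omega)}$ for $\mathbf{v}\in\mathbf{W}^{1,q}_0(\omega,\Omega)$. Stokes projection. Given $(\mathbf{u},p)\in\mathbf{W}^{1,1}_0(\Omega)\times\mathring{L}^1(\Omega)$ with $\operatorname{div}\mathbf{u}=0$, its Stokes projection is the pair $(\mathbf{U}_h,P_h)\in\mathbf{X}_h\times M_h$ with $2\mu\int_\Omega\boldsymbol{\varepsilon}(\mathbf{u}-\mathbf{U}_h):\boldsymbol{\varepsilon}(\mathbf{v}_h)\,dx-\int_\Omega(p-P_h)\operatorname{div}\mathbf{v}_h\,dx=0$ for all $\mathbf{v}_h\in\mathbf{X}_h$ and $\int_\Omega\operatorname{div}(\mathbf{u}-\mathbf{U}_h)\,r_h\,dx=0$ for all $r_h\in M_h$. *)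

(* Defs.v *)
From HB Require Import structures.
From mathcomp Require Import all_boot all_order all_algebra.
From mathcomp Require Import all_classical all_reals all_analysis.
From mathcomp Require Import ess_sup_inf.

Set Implicit Arguments.
Unset Strict Implicit.
Unset Printing Implicit Defensive.

Import Order.TTheory GRing.Theory Num.Theory.
Import numFieldNormedType.Exports.

Local Open Scope classical_set_scope.
Local Open Scope ring_scope.

(* The physical space.  The library norm of a product is the sup norm, which
   gives the right topology; Euclidean lengths go through [enorm]. *)
Notation R3 R := (R%type * R%type * R%type)%type.

Section Space.
Context {R : realType}.

Definition vol : {measure set (R3 (measurableTypeR R)) -> \bar R} :=
  ((@lebesgue_measure R \x @lebesgue_measure R) \x @lebesgue_measure R)%E.

Definition coord (x : R3 R) (i : 'I_3) : R :=
  nth 0 [:: x.1.1; x.1.2; x.2] i.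

Definition basis (i : 'I_3) : R3 R :=
  ((i == 0 :> nat)%:R, (i == 1 :> nat)%:R, (i == 2 :> nat)%:R).

Definition enorm (x : R3 R) : R := Num.sqrt (\sum_i coord x i ^+ 2).

Definition eball (c : R3 R) (r : R) : set (R3 R) :=
  [set x | enorm (x - c) < r].

Definition convex_polyhedron (Omega : set (R3 R)) : Prop :=
  [/\ Omega !=set0, bounded_set Omega &
      exists (n : nat) (a : 'I_n -> 'I_3 -> R) (b : 'I_n -> R),
        Omega = [set x | forall k, \sum_i a k i * coord x i < b k]].

End Space.

Section Tensors.
Context {R : realType}.

Definition ddot m n (A B : 'M[R]_(m, n)) : R :=
  \sum_i \sum_j A i j * B i j.

Definition fro m n (A : 'M[R]_(m, n)) : R := Num.sqrt (ddot A A).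

End Tensors.

Section Muckenhoupt.
Context {R : realType}.
Implicit Types (w : R3 R -> R) (B : set (R3 R)) (q : R).

Definition weight w : Prop :=
  [/\ measurable_fun setT w,
      {ae vol, forall x, 0 < w x} &
      forall K, compact K -> vol.-integrable K (EFin \o w)].

Definition average B (f : R3 R -> R) : \bar R :=
  ((fine (vol B))^-1%:E * \int[vol]_(x in B) (f x)%:E)%E.

(* The pointwise supremum of 1 / w over a ball is taken as an essential
   supremum, w being defined up to null sets. *)
Definition A1_const w : \bar R :=
  ereal_sup [set z | exists c (r : R), 0 < r /\
    z = (average (eball c r) w
         * ess_sup vol (fun x => (\1_(eball c r) x / w x)%R%:E))%E].

Definition Aq_const q w : \bar R :=
  ereal_sup [set z | exists c (r : R), 0 < r /\
    z = (average (eball c r) w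
         * (average (eball c r) (fun x => w x `^ (1 - q)^-1)%R) `^ (q - 1))%E].

Definition muckenhoupt q w : Prop :=
  weight w /\
  ((q = 1 /\ (A1_const w < +oo)%E) \/ (1 < q /\ (Aq_const q w < +oo)%E)).

Definition conj_exp q : R := q / (q - 1).
Definition conj_weight q w : R3 R -> R := fun x => w x `^ (1 - q)^-1.
Definition unit_weight : R3 R -> R := fun=> 1.

End Muckenhoupt.

Section Lebesgue.
Context {R : realType}.
Implicit Types (Omega : set (R3 R)) (w : R3 R -> R) (q : R).

Definition in_Lq Omega q w (f : R3 R -> R) : Prop :=
  measurable_fun Omega f /\
  (\int[vol]_(x in Omega) (`|f x| `^ q * w x)%:E < +oo)%E.

Definition norm_Lq Omega q w (f : R3 R -> R) : R :=
  (\int[vol]_(x in Omega) (`|f x| `^ q * w x)) `^ q^-1.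

Definition in_Lq0 Omega q w (f : R3 R -> R) : Prop :=
  in_Lq Omega q w f /\ \int[vol]_(x in Omega) f x = 0.

Definition in_Lqt m n Omega q w (F : R3 R -> 'M[R]_(m, n)) : Prop :=
  (forall i j, measurable_fun Omega (fun x => F x i j)) /\
  in_Lq Omega q w (fun x => fro (F x)).

Definition norm_Lqt m n Omega q w (F : R3 R -> 'M[R]_(m, n)) : R :=
  norm_Lq Omega q w (fun x => fro (F x)).

Definition in_Linf Omega (f : R3 R -> R) : Prop :=
  measurable_fun Omega f /\
  exists M : R, {ae vol, forall x, Omega x -> `|f x| <= M}.

Definition in_Linft m n Omega (F : R3 R -> 'M[R]_(m, n)) : Prop :=
  (forall i j, measurable_fun Omega (fun x => F x i j)) /\
  in_Linf Omega (fun x => fro (F x)).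

Definition in_L1loc Omega (f : R3 R -> R) : Prop :=
  measurable_fun Omega f /\
  forall K, compact K -> K `<=` Omega -> vol.-integrable K (EFin \o f).

End Lebesgue.

Section Test_functions.
Context {R : realType}.
Implicit Types (Omega : set (R3 R)) (phi : R3 R -> R).

Definition partial phi (i : 'I_3) : R3 R -> R := fun x => 'D_(basis i) phi x.

Definition iter_partial phi (s : seq 'I_3) : R3 R -> R :=
  foldr (fun i g => partial g i) phi s.

Definition smooth phi : Prop :=
  forall s, continuous (iter_partial phi s) /\
    forall x i, derivable (iter_partial phi s) x (basis i).

Definition test_function Omega phi : Prop :=
  smooth phi /\
  exists K, [/\ compact K, K `<=` Omega & forall x, ~ K x -> phi x = 0].

Definition test_field Omega (Phi : R3 R -> 'rV[R]_3) : Prop :=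
  forall i, test_function Omega (fun x => Phi x 0 i).

Definition classical_grad (Phi : R3 R -> 'rV[R]_3) : R3 R -> 'M[R]_3 :=
  fun x => \matrix_(i, j) partial (fun y => Phi y 0 i) j x.

Definition weak_partial Omega (j : 'I_3) (f g : R3 R -> R) : Prop :=
  [/\ in_L1loc Omega f, in_L1loc Omega g &
      forall phi, test_function Omega phi ->
        \int[vol]_(x in Omega) (f x * partial phi j x) =
        - \int[vol]_(x in Omega) (g x * phi x)].

Definition weak_gradient Omega (v : R3 R -> 'rV[R]_3) (G : R3 R -> 'M[R]_3)
    : Prop :=
  forall i j, weak_partial Omega j (fun x => v x 0 i) (fun x => G x i j).

End Test_functions.

(* A weakly differentiable vector field, carried by representatives of the
   field and of its weak gradient (which the field determines up to null
   sets).  All notions below are insensitive to the representatives. *)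
Record wfield (R : realType) (Omega : set (R3 R)) := WField {
  field_of :> R3 R -> 'rV[R]_3;
  grad : R3 R -> 'M[R]_3;
  wfieldP : weak_gradient Omega field_of grad }.

Section Sobolev.
Context {R : realType} {Omega : set (R3 R)}.
Implicit Types (u v : wfield Omega) (w : R3 R -> R) (q : R).

Definition eps u : R3 R -> 'M[R]_3 :=
  fun x => 2^-1 *: (grad u x + (grad u x)^T).

Definition div u : R3 R -> R := fun x => \tr (grad u x).

Definition in_W1q q w v : Prop :=
  in_Lqt Omega q w v /\ in_Lqt Omega q w (grad v).

(* Closure of the test fields in the W^{1,q}(w) norm. *)
Definition in_W1q0 q w v : Prop :=
  in_W1q q w v /\
  exists Phi : nat -> R3 R -> 'rV[R]_3,
    [/\ forall n, test_field Omega (Phi n),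
        norm_Lqt Omega q w (fun x => Phi n x - v x) @[n --> \oo] --> (0 : R) &
        norm_Lqt Omega q w (fun x => classical_grad (Phi n) x - grad v x)
          @[n --> \oo] --> (0 : R)].

(* For q = oo the norm closure of the test fields only contains C^1 fields;
   the zero-trace space is their closure under bounded weak-* convergence. *)
Definition in_W1inf0 v : Prop :=
  [/\ in_Linft Omega v, in_Linft Omega (grad v) &
  exists (Phi : nat -> R3 R -> 'rV[R]_3) (M : R),
    [/\ forall n, test_field Omega (Phi n),
        forall n x, fro (Phi n x) <= M /\ fro (classical_grad (Phi n) x) <= M,
        forall (g : R3 R -> R) i, in_Lq Omega 1 unit_weight g ->
          \int[vol]_(x in Omega) (Phi n x 0 i * g x) @[n --> \oo] -->
          \int[vol]_(x in Omega) (v x 0 i * g x) &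
        forall (g : R3 R -> R) i j, in_Lq Omega 1 unit_weight g ->
          \int[vol]_(x in Omega) (classical_grad (Phi n) x i j * g x)
            @[n --> \oo] -->
          \int[vol]_(x in Omega) (grad v x i j * g x)]].

(* [D2 k] represents the weak derivative of [grad v] in direction [k]. *)
Definition weak_hessian v (D2 : 'I_3 -> R3 R -> 'M[R]_3) : Prop :=
  forall k i j, weak_partial Omega k (fun x => grad v x i j)
                                     (fun x => D2 k x i j).

Definition in_W2q q v (D2 : 'I_3 -> R3 R -> 'M[R]_3) : Prop :=
  [/\ in_W1q q unit_weight v, weak_hessian v D2 &
      forall k, in_Lqt Omega q unit_weight (D2 k)].

Definition norm_W2q q v (D2 : 'I_3 -> R3 R -> 'M[R]_3) : R :=
  (norm_Lqt Omega q unit_weight v `^ q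
   + norm_Lqt Omega q unit_weight (grad v) `^ q
   + \sum_k norm_Lqt Omega q unit_weight (D2 k) `^ q) `^ q^-1.

Definition in_W1q_scalar q (r : R3 R -> R) (D : 'I_3 -> R3 R -> R) : Prop :=
  [/\ in_Lq Omega q unit_weight r,
      forall j, weak_partial Omega j r (D j) &
      forall j, in_Lq Omega q unit_weight (D j)].

Definition norm_W1q_scalar q (r : R3 R -> R) (D : 'I_3 -> R3 R -> R) : R :=
  (norm_Lq Omega q unit_weight r `^ q
   + \sum_j norm_Lq Omega q unit_weight (D j) `^ q) `^ q^-1.

Definition Xq q w : set (wfield Omega) :=
  [set v | in_W1q0 2 unit_weight v /\ in_W1q0 q w v].

Definition Mq q w : set (R3 R -> R) :=
  [set p | exists p1 p2, [/\ in_Lq0 Omega 2 unit_weight p1,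
     in_Lq0 Omega (conj_exp q) (conj_weight q w) p2 &
     forall x, Omega x -> p x = p1 x + p2 x]].

Definition in_sum_Lqt q w (F : R3 R -> 'M[R]_3) : Prop :=
  exists F1 F2 : R3 R -> 'M[R]_3, [/\ in_Lqt Omega 2 unit_weight F1,
    in_Lqt Omega (conj_exp q) (conj_weight q w) F2 &
    forall x, Omega x -> F x = F1 x + F2 x].

End Sobolev.
Arguments Xq {R} Omega q w.
Arguments Mq {R} Omega q w.
Arguments in_sum_Lqt {R} Omega q w F.
Arguments in_W1q_scalar {R} Omega q r D.
Arguments norm_W1q_scalar {R} Omega q r D.

Section Triangulations.
Context {R : realType}.

Definition barycentric (l : 'I_4 -> R) : Prop :=
  (forall i, 0 <= l i) /\ \sum_i l i = 1.

(* The closed tetrahedron with the four given vertices. *)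
Definition tetrahedron (t : 4.-tuple (R3 R)) : set (R3 R) :=
  [set x | exists2 l, barycentric l & x = \sum_i l i *: tnth t i].

Definition common_face (s t : 4.-tuple (R3 R)) : set (R3 R) :=
  [set x | exists l, [/\ barycentric l,
     forall i, l i != 0 -> exists j, tnth s i = tnth t j &
     x = \sum_i l i *: tnth s i]].

Definition triangulation (Omega : set (R3 R)) (T : set (4.-tuple (R3 R)))
    : Prop :=
  [/\ finite_set T,
      closure Omega = \bigcup_(t in T) tetrahedron t &
      forall s t, T s -> T t ->
        tetrahedron s `&` tetrahedron t = common_face s t].

(* Every element has diameter at most [h] and contains a ball of radius
   [sigma * h]; quasiuniformity asks for [sigma] independent of [h]. *)
Definition quasiuniform_size (sigma h : R) (T : set (4.-tuple (R3 R))) : Prop :=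
  forall t, T t ->
    (forall x y, tetrahedron t x -> tetrahedron t y -> enorm (x - y) <= h) /\
    exists c, eball c (sigma * h) `<=` tetrahedron t.

Definition polynomial3 (k : nat) (c : nat -> nat -> nat -> R) (x : R3 R) : R :=
  \sum_(a < k.+1) \sum_(b < k.+1) \sum_(d < k.+1 | (a + b + d <= k)%N)
    c a b d * x.1.1 ^+ a * x.1.2 ^+ b * x.2 ^+ d.

Definition piecewise_polynomial (k : nat) (T : set (4.-tuple (R3 R)))
    (f : R3 R -> R) : Prop :=
  forall t, T t -> exists c,
    {ae vol, forall x, tetrahedron t x -> f x = polynomial3 k c x}.

End Triangulations.

Section Finite_elements.
Context {R : realType} (Omega : set (R3 R)).

(* Both spaces are saturated under a.e. equality on [Omega]. *)
Definition finite_dim_fields (V : set (wfield Omega)) : Prop :=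
  exists (n : nat) (b : 'I_n -> wfield Omega), forall v, V v <->
    exists c : 'I_n -> R,
      {ae vol, forall x, Omega x -> v x = \sum_k c k *: b k x}.

Definition finite_dim_functions (M : set (R3 R -> R)) : Prop :=
  exists (n : nat) (b : 'I_n -> R3 R -> R), forall r, M r <->
    measurable_fun Omega r /\ exists c : 'I_n -> R,
      {ae vol, forall x, Omega x -> r x = \sum_k c k * b k x}.

Definition dist_grad q w (V : set (wfield Omega)) (v : wfield Omega) : R :=
  inf [set norm_Lqt Omega q w (fun x => grad v x - grad vh x) | vh in V].

Definition nonzero_field (v : wfield Omega) : Prop :=
  ~ {ae vol, forall x, Omega x -> v x = 0}.

Definition inf_sup_quotient q w (p : R3 R -> R) (v : wfield Omega) : R :=
  (\int[vol]_(x in Omega) (p x * div v x)) / norm_Lqt Omega q w (grad v).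

Definition inf_sup_stable (H : set R) (Xh : R -> set (wfield Omega))
    (Mh : R -> set (R3 R -> R)) : Prop :=
  forall q w, 1 < q -> muckenhoupt q w ->
  exists2 C : R, 0 < C & forall h, H h -> forall ph, Mh h ph ->
    ((norm_Lq Omega (conj_exp q) (conj_weight q w) ph)%:E <=
     C%:E * ereal_sup [set (inf_sup_quotient q w ph vh)%:E
                      | vh in Xh h `&` nonzero_field])%E.

(* First order approximation in the unweighted Sobolev scale. *)
Definition usual_approximation (H : set R) (Xh : R -> set (wfield Omega))
    (Mh : R -> set (R3 R -> R)) : Prop :=
  forall q, 1 < q ->
  exists2 C : R, 0 < C & forall h, H h ->
    (forall v D2, in_W1q0 q unit_weight v -> in_W2q q v D2 ->
       dist_grad q unit_weight (Xh h) v <= C * h * norm_W2q q v D2) /\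
    (forall r D, in_Lq0 Omega q unit_weight r -> in_W1q_scalar Omega q r D ->
       inf [set norm_Lq Omega q unit_weight (fun x => r x - rh x) | rh in Mh h]
       <= C * h * norm_W1q_scalar Omega q r D).

Definition stable_interpolation (H : set R) (Xh : R -> set (wfield Omega))
    (Ih : R -> (R3 R -> 'rV[R]_3) -> wfield Omega) : Prop :=
  [/\ forall h, H h -> forall v, in_Lqt Omega 1 unit_weight v ->
        Xh h (Ih h v) /\
        forall v', in_Lqt Omega 1 unit_weight v' ->
          {ae vol, forall x, Omega x -> v x = v' x} ->
          {ae vol, forall x, Omega x -> Ih h v x = Ih h v' x},
      exists2 C : R, 0 < C & forall h, H h ->
        forall v, in_Lqt Omega 1 unit_weight v ->
          norm_Lqt Omega 1 unit_weight (Ih h v)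
          <= C * norm_Lqt Omega 1 unit_weight v,
      forall h, H h -> forall vh, Xh h vh ->
        {ae vol, forall x, Omega x -> Ih h vh x = vh x},
      exists2 C : R, 0 < C & forall h, H h -> forall (v : wfield Omega) D2,
        in_W1q0 2 unit_weight v -> in_W2q 2 v D2 ->
        {ae vol, forall x, Omega x ->
           fro (v x - Ih h v x) <= C * h `^ 2^-1 * norm_W2q 2 v D2} &
      forall q w, 1 < q -> muckenhoupt q w ->
        exists2 C : R, 0 < C & forall h, H h -> forall v : wfield Omega,
          in_W1q0 q w v ->
          norm_Lqt Omega q w (fun x => grad v x - grad (Ih h v) x)
          <= C * dist_grad q w (Xh h) v].

(* [H] is the set of available mesh sizes: a bounded domain has no
   quasiuniform triangulation of size comparable to h when h is large. *)
Record fe_family (H : set R) (Th : R -> set (4.-tuple (R3 R)))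
    (Xh : R -> set (wfield Omega)) (Mh : R -> set (R3 R -> R)) : Prop := {
  fe_size_gt0 : forall h, H h -> 0 < h;
  fe_triangulation : forall h, H h -> triangulation Omega (Th h);
  fe_quasiuniform : exists2 sigma : R, 0 < sigma &
    forall h, H h -> quasiuniform_size sigma h (Th h);
  fe_velocity_conforming : forall h, H h -> forall v, Xh h v -> in_W1inf0 v;
  fe_pressure_conforming : forall h, H h -> forall r, Mh h r ->
    in_Linf Omega r /\ in_Lq0 Omega 2 unit_weight r;
  fe_velocity_finite_dim : forall h, H h -> finite_dim_fields (Xh h);
  fe_pressure_finite_dim : forall h, H h -> finite_dim_functions (Mh h);
  fe_piecewise_polynomial : exists k : nat, forall h, H h ->
    (forall v i, Xh h v -> piecewise_polynomial k (Th h) (fun x => v x 0 i)) /\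
    (forall r, Mh h r -> piecewise_polynomial k (Th h) r);
  fe_inf_sup : inf_sup_stable H Xh Mh;
  fe_approximation : usual_approximation H Xh Mh;
  fe_interpolation : exists Ih, stable_interpolation H Xh Ih }.

End Finite_elements.

Section Problem.
Context {R : realType} {Omega : set (R3 R)}.
Implicit Types (V : set (wfield Omega)) (M : set (R3 R -> R)).

Definition stress (mu q : R) (w : R3 R -> R) (x : R3 R) (Q : 'M[R]_3)
    : 'M[R]_3 :=
  (2 * (mu + w x * fro Q `^ (q - 2))) *: Q.

(* Solutions of the mixed problem posed on the pair of spaces (V, M). *)
Definition mixed_solution (mu q : R) (w : R3 R -> R) (f : R3 R -> 'M[R]_3)
    V M (u : wfield Omega) (p : R3 R -> R) : Prop :=
  [/\ V u, M p,
      forall v, V v ->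
        \int[vol]_(x in Omega) ddot (stress mu q w x (eps u x)) (eps v x)
        - \int[vol]_(x in Omega) (p x * div v x)
        = \int[vol]_(x in Omega) ddot (f x) (grad v x) &
      forall r, M r -> \int[vol]_(x in Omega) (div u x * r x) = 0].

Definition stokes_projection (mu : R) V M (u : wfield Omega) (p : R3 R -> R)
    (U : wfield Omega) (P : R3 R -> R) : Prop :=
  [/\ V U, M P,
      forall v, V v ->
        2 * mu * \int[vol]_(x in Omega) ddot (eps u x - eps U x) (eps v x)
        - \int[vol]_(x in Omega) ((p x - P x) * div v x) = 0 &
      forall r, M r ->
        \int[vol]_(x in Omega) ((div u x - div U x) * r x) = 0].

End Problem.

(* Main.v *)
(* Discrete velocities may be used as test fields in the continuous problem:
   smooth compactly supported fields may, and every field of W^{1,oo}_0 is a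
   bounded weak-* limit of those, while the stress, the pressure and the forcing
   are integrable.  Together with the Stokes projection this gives
     int (S(eps u) - S(eps u_h) - 2 mu eps(u - U_h)) : eps(U_h - u_h) = 0,
   the pressures dropping out because of the divergence constraints.
   Monotonicity of |Q|^(q-2) Q and Young's inequality with a free scale s bound
   the left-hand side of the theorem by
     ||eps(u - U_h)||_2^2 + s^2 (energies + N^q / s^q),
   where N is the weighted norm of eps(u - U_h).  The choice s = N gives N^2,
   which is at most N^(q/(q-1)) if N <= 1; for N > 1 the energies alone suffice.
   The energies of u and u_h are bounded by those of one fixed solution (u0, p0):
   its equation, tested with u or u_h, expresses the action of f, so that neither
   Korn's inequality nor the inf-sup condition is needed. *)

(* The energies enter because the flux F(Q) = |Q|^(q-2) Q is only locally Lipschitz: |F(A) - F(B)|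
   is controlled by |A|^(q-2) + |B|^(q-2) times |A - B|. After absorption the projection error
   therefore carries a weight that grows with both solutions, and only bounds uniform in [u], [uh]
   and the mesh size turn it into a constant. Such bounds must come from the data, but the constant
   has to be chosen before [u] and [p] are known. Anchoring everything at one reference solution
   settles this: the reference stress and pressure replace the forcing, and Young's inequality
   absorbs every occurrence of the strain to be bounded. The second obstacle is the zero trace. [Xq]
   asks for norm approximation by test fields and [in_W1inf0] only for a bounded weak-* one, so what
   is transferred to discrete fields is a single identity, linear in the gradient with an integrable
   coefficient. This is why integrability is tracked for each term separately. *)
Require Import Defs.
From HB Require Import structures.
From mathcomp Require Import all_boot all_order all_algebra.
From mathcomp Require Import all_classical all_reals all_analysis.
From mathcomp Require Import measurable_realfun ring lra.

Set Implicit Arguments.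
Unset Strict Implicit.
Unset Printing Implicit Defensive.

Import Order.TTheory GRing.Theory Num.Theory.
Import numFieldNormedType.Exports.
Local Open Scope classical_set_scope.
Local Open Scope ring_scope.

(** * Measurability of open sets of space *)
Section OpenMeasurable.
Context {R : realType}.

Definition rat_box (r : rat * rat * (rat * rat) * (rat * rat)) : set (R3 R) :=
  [set x | [/\ ratr r.1.1.1 < x.1.1 < ratr r.1.1.2,
               ratr r.1.2.1 < x.1.2 < ratr r.1.2.2 &
               ratr r.2.1 < x.2 < ratr r.2.2]].

Lemma measurable_rat_box r :
  measurable (rat_box r : set (R3 (measurableTypeR R))).
Proof.
pose I (a : rat * rat) : set (measurableTypeR R) := `]ratr a.1, ratr a.2[%classic.
have -> : rat_box r = (I r.1.1 `*` I r.1.2) `*` I r.2.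
  by apply/seteqP; split=> x; rewrite /rat_box /I /= ?in_itv /=;
    [move=> [-> -> ->]|move=> [[]]].
by apply: measurableX; [apply: measurableX|]; exact: measurable_itv.
Qed.

Lemma rat_itv_nbhs (x : R) (A : set R) : nbhs x A ->
  exists a : rat * rat, ratr a.1 < x < ratr a.2 /\
    forall y, ratr a.1 < y < ratr a.2 -> A y.
Proof.
move=> /nbhs_ballP[e /= e0 eA].
have h1 : x - e < x by rewrite ltrBlDr ltrDl.
have h2 : x < x + e by rewrite ltrDl.
have [a] := rat_in_itvoo h1; rewrite in_itv /= => /andP[a1 a2].
have [b] := rat_in_itvoo h2; rewrite in_itv /= => /andP[b1 b2].
exists (a, b); rewrite /= a2 b1; split => // y /andP[ay yb].
apply: eA; rewrite /ball /= ltr_distlC.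
by rewrite (lt_trans a1 ay) (lt_trans yb b2).
Qed.

Lemma rat_box_nbhs (x : R3 R) (A : set (R3 R)) : nbhs x A ->
  exists r, rat_box r x /\ rat_box r `<=` A.
Proof.
case: x => [[x y] z] [[P Q] /= [nP nQ] PQA].
case: nP => [[P1 P2] /= [nP1 nP2] PP].
have [a [ax aP]] := rat_itv_nbhs nP1.
have [b [bx bP]] := rat_itv_nbhs nP2.
have [c [cx cP]] := rat_itv_nbhs nQ.
exists (a, b, c); split; first by split.
move=> [[u v] s] [/= hu hv hs]; apply: PQA; split => /=; last exact: cP.
by apply: PP; split; [exact: aP|exact: bP].
Qed.

(** Openness refers to the product topology, measurability to the product sigma-algebra; the
    countable base of rational boxes links the two. *)
Lemma open_measurable3 (A : set (R3 R)) :
  open A -> measurable (A : set (R3 (measurableTypeR R))).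
Proof.
move=> oA.
(* Boxes that leave [A] are replaced by the empty set, so that the union runs over a whole countable
   type. *)
have -> : A = \bigcup_r (if `[< rat_box r `<=` A >] then rat_box r else set0).
  apply/seteqP; split=> [x Ax|x [r _]].
    have [r [rx rA]] := rat_box_nbhs (open_nbhs_nbhs (conj oA Ax)).
    by exists r => //; case: asboolP.
  by case: asboolP => // rA; exact: rA.
have mB r : measurable (if `[< rat_box r `<=` A >] then rat_box r else set0
    : set (R3 (measurableTypeR R))).
  by case: ifP => // _; exact: measurable_rat_box.
exact: (countable_bigcupT_measurable (countableP _) mB).
Qed.

Lemma closed_measurable3 (A : set (R3 R)) :
  closed A -> measurable (A : set (R3 (measurableTypeR R))).
Proof.
move=> cA; rewrite -(setCK A); apply: measurableC; apply: open_measurable3.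
exact: closed_openC.
Qed.

Lemma continuous_measurable3 (f : R3 R -> R) : continuous f ->
  measurable_fun setT (f : R3 (measurableTypeR R) -> R).
Proof.
move=> /continuousP cf; apply: (measurability _ (@RGenOpens.measurableE R)).
move=> _ [_ [a [b ->] <-]]; rewrite setTI.
by apply: open_measurable3; apply: cf; exact: interval_open.
Qed.

Lemma compact_bounded_coord (K : set (R3 R)) : compact K ->
  exists M : R, 0 < M /\
    forall x : R3 R, K x -> [/\ `|x.1.1| <= M, `|x.1.2| <= M & `|x.2| <= M].
Proof.
move=> /compact_bounded /ex_strict_bound_gt0[M M0 KM]; exists M; split => // x Kx.
have := KM x Kx => /= /ltW.
case: x {Kx} => [[a b] c] /=.
by rewrite /Num.norm /= !ge_max => /andP[/andP[]].
Qed.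

Lemma compact_closed3 (K : set (R3 R)) : compact K -> closed K.
Proof. by apply: compact_closed; exact: norm_hausdorff. Qed.

Definition box (M : R) : set (R3 R) :=
  (`[- M, M]%classic `*` `[- M, M]%classic) `*` `[- M, M]%classic.

Lemma measurable_box M : measurable (box M : set (R3 (measurableTypeR R))).
Proof. by apply: measurableX; [apply: measurableX|]; exact: measurable_itv. Qed.

Lemma vol_box M : (vol (box M) < +oo)%E.
Proof.
have I0 : measurable (`[- M, M]%classic : set (measurableTypeR R)).
  exact: measurable_itv.
rewrite /vol /box /= product_measure1E//; last exact: measurableX.
have lI : lebesgue_measure (`[- M, M]%classic : set R) \is a fin_num.
  by rewrite lebesgue_measure_itv /=; case: ifP.
rewrite /= product_measure1E//.
by have := fin_numM (fin_numM lI lI) lI; rewrite ltey_eq => ->.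
Qed.

Lemma compact_subset_box (K : set (R3 R)) : compact K ->
  exists M : R, 0 < M /\ K `<=` box M.
Proof.
move=> /compact_bounded_coord[M [M0 KM]]; exists M; split => // x /KM[h1 h2 h3].
by split; [split|] => /=; rewrite in_itv /= -ler_norml.
Qed.

Lemma compact_box M : compact (box M).
Proof.
by apply: compact_setX; [apply: compact_setX|]; exact: segment_compact.
Qed.

End OpenMeasurable.

(** * Integration by parts for test functions *)
Section Integration.
Context {R : realType}.

Lemma integrable_bounded_support d (T : measurableType d)
    (mu : {measure set T -> \bar R}) (B : set T) (f : T -> R) (C : R) :
  measurable B -> (mu B < +oo)%E -> measurable_fun setT f ->
  (forall x, `|f x| <= C) -> (forall x, ~ B x -> f x = 0) ->
  mu.-integrable setT (EFin \o f).
Proof.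
move=> mB muB mf fC f0.
have -> : EFin \o f = (EFin \o f) \_ B.
  apply/funext => x /=; rewrite patchE; case: ifPn => // /negP xB.
  by rewrite f0 // => Bx; apply: xB; rewrite inE.
apply/integrable_restrict => //; rewrite setTI.
apply: measurable_bounded_integrable => //; first exact: measurable_funS mf.
exists C; split; first exact: num_real.
by move=> M CM x _ /=; rewrite (le_trans (fC x)) // ltW.
Qed.

Lemma integral_derivative_eq0 (F f : R -> R) (M : R) : 0 < M ->
  (forall x : R, is_derive x (1 : R) F (f x)) -> continuous f ->
  (forall x, M < `|x| -> F x = 0) -> (forall x, M < `|x| -> f x = 0) ->
  (\int[lebesgue_measure]_x (f x)%:E = 0)%E.
Proof.
(* [F] is known to vanish only where |x| > M strictly, so the interval is widened until its
   endpoints lie there. *)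
move=> M0 dF cf F0 f0; pose N := M + 1.
have MN : M < N by rewrite ltrDl.
have N0 : 0 < N by exact: lt_trans MN.
have -> : (\int[lebesgue_measure]_x (f x)%:E =
           \int[lebesgue_measure]_(x in [set` `[- N, N]%R]) (f x)%:E)%E.
  rewrite [RHS]integral_mkcond; apply: eq_integral => x _.
  rewrite patchE; case: ifPn => //; rewrite notin_setE /= in_itv /= => /negP.
  by rewrite -ler_norml -ltNge => Nx; rewrite f0 // (lt_trans MN).
have cF x : {for x, continuous F}.
  by apply/differentiable_continuous/derivable1_diffP; exact: ex_derive.
rewrite (@continuous_FTC2 _ f F); first last.
- by move=> x _; rewrite derive1E; exact: derive_val.
- split; [by move=> x _; exact: ex_derive| |].
  + by apply: cvg_at_right_filter; exact: cF.
  + by apply: cvg_at_left_filter; exact: cF.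
- exact: continuous_subspaceT.
- by rewrite -subr_gt0 opprK addr_gt0.
- by rewrite !F0 ?subee // ?normrN gtr0_norm.
Qed.
Lemma compact_support_bounded (g : R3 R -> R) (K : set (R3 R)) :
  continuous g -> compact K -> (forall x, ~ K x -> g x = 0) ->
  exists C, forall x, `|g x| <= C.
Proof.
move=> cg cK g0.
have [C [_ HC]] : bounded_set (g @` K).
  apply: compact_bounded; apply: continuous_compact cK.
  exact: continuous_subspaceT.
exists (`|C| + 1) => x; have [xK|/g0 ->] := pselect (K x); last first.
  by rewrite normr0 addr_ge0.
apply: (HC (`|C| + 1)); last by exists x.
by rewrite (le_lt_trans (ler_norm _)) // ltrDl.
Qed.

(** Affinity of [l] is assumed in the form that makes the two difference quotients literally equal.
    Directional derivatives thus become one-dimensional ones, to which the fundamental theorem of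
    calculus applies. *)
Lemma is_derive_line (g : R3 R -> R) (l : R -> R3 R) (v : R3 R) (t : R) :
  (forall h, l (h + t) = h *: v + l t) -> derivable g (l t) v ->
  is_derive t (1 : R) (g \o l) ('D_v g (l t)).
Proof.
move=> lE dg.
have E : (fun h : R => h^-1 *: ((g \o l \o shift t) (h *: (1 : R)) - (g \o l) t))
    = (fun h => h^-1 *: ((g \o shift (l t)) (h *: v) - g (l t))).
  by apply/funext => h /=; rewrite /shift /= -lE [h *: 1]mulr1.
by split; rewrite ?/derivable ?/derive E.
Qed.

Lemma square_measure_lty (M : R) :
  ((lebesgue_measure \x lebesgue_measure)
     ((`[(- M)%R, M]%classic : set (measurableTypeR R)) `*`
      (`[(- M)%R, M]%classic : set (measurableTypeR R))) < +oo)%E.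
Proof.
rewrite product_measure1E; try exact: measurable_itv.
have lI : lebesgue_measure (`[- M, M]%classic : set R) \is a fin_num.
  by rewrite lebesgue_measure_itv /=; case: ifP.
by have := fin_numM lI lI; rewrite ltey_eq => ->.
Qed.

Section ProductIntegral.
Context d1 d2 (T1 : measurableType d1) (T2 : measurableType d2).
Variables (m1 : {sigma_finite_measure set T1 -> \bar R}).
Variables (m2 : {sigma_finite_measure set T2 -> \bar R}).
Variable f : T1 * T2 -> \bar R.
Hypothesis fi : (m1 \x m2)%E.-integrable setT f.

Lemma integral_prod_eq0_fst : (forall y, \int[m1]_x f (x, y) = 0)%E ->
  (\int[m1 \x m2]_z f z = 0)%E.
Proof.
move=> f0; rewrite -(integral21_prod_meas1 fi).
by apply: integral0_eq => y _; exact: f0.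
Qed.

Lemma integral_prod_eq0_snd : (forall x, \int[m2]_y f (x, y) = 0)%E ->
  (\int[m1 \x m2]_z f z = 0)%E.
Proof.
move=> f0; rewrite -(integral12_prod_meas1 fi).
by apply: integral0_eq => x _; exact: f0.
Qed.

End ProductIntegral.

Section SpaceIntegral.
Local Notation lam := (@lebesgue_measure R).
Local Notation RR := (measurableTypeR R * measurableTypeR R)%type.

(* The library attaches a sigma-finite structure to products of
   subprobabilities only, hence the separate constant. *)
Definition plane_measure : set RR -> \bar R := (lam \x lam)%E.

HB.instance Definition _ := Measure.on plane_measure.

Lemma plane_measure_sigma_finite : sigma_finite setT plane_measure.
Proof.
pose I (n : nat) : set (measurableTypeR R) := `[(- n%:R)%R, n%:R]%classic.
have cI (x : R) n : `|x| <= n%:R -> I n x by rewrite /I /= in_itv /= ler_norml.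
exists (fun n => I n `*` I n).
  apply/seteqP; split => // -[x y] _.
  have [n hn] : exists n : nat, `|x| + `|y| <= n%:R.
    by exists (Num.bound (`|x| + `|y|)); rewrite ltW // archi_boundP // addr_ge0.
  by exists n => //; split => /=; apply: cI; apply: le_trans hn;
    rewrite ?lerDl ?lerDr.
move=> n; split; last exact: square_measure_lty.
by apply: measurableX; exact: measurable_itv.
Qed.

HB.instance Definition _ := Measure_isSigmaFinite.Build _ RR R plane_measure
  plane_measure_sigma_finite.

(** Holds by conversion: [vol] unfolds to the product of [plane_measure] and the line, and Fubini
    applies since the plane is sigma-finite. *)
Lemma vol_integral_eq0_fst (f : R3 (measurableTypeR R) -> \bar R) :
  vol.-integrable setT f ->
  (forall z, \int[(lam \x lam)%E]_x f (x, z) = 0)%E ->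
  (\int[vol]_x f x = 0)%E.
Proof.
exact: (@integral_prod_eq0_fst _ _ RR (measurableTypeR R) plane_measure lam f).
Qed.

Lemma vol_integral_eq0_snd (f : R3 (measurableTypeR R) -> \bar R) :
  vol.-integrable setT f ->
  (forall x, \int[lam]_z f (x, z) = 0)%E -> (\int[vol]_x f x = 0)%E.
Proof.
exact: (@integral_prod_eq0_snd _ _ RR (measurableTypeR R) plane_measure lam f).
Qed.

End SpaceIntegral.

Lemma scale_basisD (i : 'I_3) (h : R) (x : R3 R) :
  h *: Defs.basis i + x =
  (h * (i == 0 :> nat)%:R + x.1.1, h * (i == 1 :> nat)%:R + x.1.2,
   h * (i == 2 :> nat)%:R + x.2).
Proof. by case: x => [[a b] c]. Qed.

Lemma continuous_triple (a b c : R -> R) :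
  continuous a -> continuous b -> continuous c ->
  continuous (fun t => (a t, b t, c t) : R3 R).
Proof.
by move=> ca cb cc t; exact: (cvg_pair (cvg_pair (ca t) (cb t)) (cc t)).
Qed.

Section CompactSupport.
Variables (g : R3 R -> R) (i : 'I_3) (M : R).
Hypotheses (M0 : 0 < M) (dg : forall x, derivable g x (Defs.basis i)).
Hypotheses (cpg : continuous (partial g i)).
Hypothesis g0 : forall x, ~ box M x -> g x = 0.

Lemma partial_support x : ~ box M x -> partial g i x = 0.
Proof.
move=> xM; have oB : open (~` box M).
  by apply: closed_openC; apply: compact_closed3; exact: compact_box.
rewrite /partial (@near_eq_derive _ _ _ g (fun=> 0)); last first.
  by have := open_nbhs_nbhs (conj oB xM); apply: filterS => y; exact: g0.
by rewrite derive_cst.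
Qed.

Lemma box_out (x : R3 R) : M < `|x.1.1| \/ M < `|x.1.2| \/ M < `|x.2| -> ~ box M x.
Proof.
move=> h [[/= + +]]; rewrite !in_itv /= -!ler_norml => h1 h2 h3.
by case: h => [|[]]; rewrite ltNge ?h1 ?h2 ?h3.
Qed.

(** Fubini isolates the coordinate of differentiation; along each line in that direction the
    derivative of a compactly supported function integrates to zero. *)
Lemma integral_partial : (\int[vol]_x (partial g i x)%:E = 0)%E.
Proof.
have [C HC] := compact_support_bounded cpg (@compact_box R M) partial_support.
have mp : measurable_fun setT (partial g i : R3 (measurableTypeR R) -> R).
  exact: continuous_measurable3.
have ip : vol.-integrable setT (EFin \o partial g i).
  apply: (integrable_bounded_support (measurable_box M) (vol_box M) mp HC).
  exact: partial_support.
have ip2 c : (lebesgue_measure \x lebesgue_measure)%E.-integrable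
    [set: measurableTypeR R * measurableTypeR R]
    (EFin \o (fun xy => partial g i (xy, c))).
  have mI : measurable (`[- M, M]%classic : set (measurableTypeR R)).
    exact: measurable_itv.
  apply: (@integrable_bounded_support _ (measurableTypeR R * measurableTypeR R)%type
    (lebesgue_measure \x lebesgue_measure)%E
    (`[- M, M]%classic `*` `[- M, M]%classic) (fun xy => partial g i (xy, c)) C).
  - exact: measurableX.
  - exact: square_measure_lty.
  - exact: (measurableT_comp mp).
  - by move=> x; exact: HC.
  - by move=> x xB; apply: partial_support => -[].
have inner (l : R -> R3 R) : (forall h t, l (h + t) = h *: Defs.basis i + l t) ->
    continuous l ->
    (forall t, M < `|t| -> ~ box M (l t)) ->
    (\int[lebesgue_measure]_t (partial g i (l t))%:E = 0)%E.
  move=> lE cl lM; apply: (@integral_derivative_eq0 (g \o l) _ M) => //.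
  - by move=> t; apply: is_derive_line.
  - by move=> t; apply: continuous_comp; [exact: cl|exact: cpg].
  - by move=> t /lM /g0.
  - by move=> t /lM /partial_support.
clear HC mp.
(* The direction fixes the order of integration: the first two need a second Fubini inside the
   plane, for which [ip2] gives integrability of the slices; the third needs the outer one only. *)
case: (i) ip ip2 inner => [[|[|[|//]]] k] /= ip ip2 inner.
- apply: (vol_integral_eq0_fst ip) => c.
  apply: (@integral_prod_eq0_fst _ _ (measurableTypeR R) (measurableTypeR R)
    lebesgue_measure lebesgue_measure _ (ip2 c)) => b.
  apply: (inner (fun t => ((t, b), c))) => [h t|t|t Mt].
  + by rewrite scale_basisD /= ?mulr1 ?mulr0 ?add0r.
  + apply: continuous_triple => z; (exact: cvg_id || exact: cvg_cst).
  + by apply: (@box_out ((t, b), c)); left.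
- apply: (vol_integral_eq0_fst ip) => c.
  apply: (@integral_prod_eq0_snd _ _ (measurableTypeR R) (measurableTypeR R)
    lebesgue_measure lebesgue_measure _ (ip2 c)) => a.
  apply: (inner (fun t => ((a, t), c))) => [h t|t|t Mt].
  + by rewrite scale_basisD /= ?mulr1 ?mulr0 ?add0r.
  + apply: continuous_triple => z; (exact: cvg_id || exact: cvg_cst).
  + by apply: (@box_out ((a, t), c)); right; left.
- apply: (vol_integral_eq0_snd ip) => x.
  case: x => a b; apply: (inner (fun t => ((a, b), t))) => [h t|t|t Mt].
  + by rewrite scale_basisD /= ?mulr1 ?mulr0 ?add0r.
  + apply: continuous_triple => z; (exact: cvg_id || exact: cvg_cst).
  + by apply: (@box_out ((a, b), t)); right; right.
Qed.

End CompactSupport.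
End Integration.

(** * Test functions: supports, boundedness, and classical derivatives as weak ones *)

Section TestFunctions.
Context {R : realType}.
Implicit Types (Omega : set (R3 R)) (phi psi : R3 R -> R).

Lemma continuous_integrable3 phi (K : set (R3 R)) :
  continuous phi -> compact K -> vol.-integrable K (EFin \o phi).
Proof.
move=> cphi cK; have [M [M0 KM]] := compact_subset_box cK.
have mK : measurable (K : set (R3 (measurableTypeR R))).
  by apply: closed_measurable3; exact: compact_closed3.
apply: measurable_bounded_integrable => //.
- by apply: le_lt_trans (vol_box M); apply: le_measure; rewrite ?inE //;
    exact: measurable_box.
- by apply: measurable_funTS; exact: continuous_measurable3.
- have : bounded_set (phi @` K).
    apply: compact_bounded; apply: continuous_compact cK.
    exact: continuous_subspaceT.
  by case=> C [rC HC]; exists C; split => // x Cx y Ky; apply: (HC x Cx); exists y.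
Qed.

Lemma test_function_continuous Omega phi : test_function Omega phi ->
  continuous phi.
Proof. by move=> [sphi _]; have [] := sphi [::]. Qed.

Lemma test_function_derivable Omega phi x i : test_function Omega phi ->
  derivable phi x (Defs.basis i).
Proof. by move=> [sphi _]; have [_] := sphi [::]; exact. Qed.

Lemma test_function_partial_continuous Omega phi i : test_function Omega phi ->
  continuous (partial phi i).
Proof. by move=> [sphi _]; have [] := sphi [:: i]. Qed.

Lemma test_function_support Omega phi : test_function Omega phi ->
  exists M K, [/\ 0 < M, compact K, K `<=` box M, K `<=` Omega &
    forall x, ~ K x -> phi x = 0].
Proof.
move=> [_ [K [cK KO K0]]]; have [M [M0 KM]] := compact_subset_box cK.
by exists M, K.
Qed.

Lemma closed_partial_support phi (K : set (R3 R)) i x : closed K ->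
  (forall x, ~ K x -> phi x = 0) -> ~ K x -> partial phi i x = 0.
Proof.
move=> cK K0 xK.
rewrite /partial (@near_eq_derive _ _ _ phi (fun=> 0)); last first.
  have := open_nbhs_nbhs (conj (closed_openC cK) xK).
  by apply: filterS => y; exact: K0.
by rewrite derive_cst.
Qed.

(** The integral of the derivative of [phi * psi] vanishes. This makes test fields instances of
    [wfield], hence admissible in the continuous problem. *)
Lemma test_function_weak_partial Omega phi j : test_function Omega phi ->
  weak_partial Omega j phi (partial phi j).
Proof.
move=> tphi; have cphi := test_function_continuous tphi.
have cpphi := test_function_partial_continuous (i:=j) tphi.
split.
- by split=> [|K cK _];
    [apply: measurable_funTS; exact: continuous_measurable3
    |exact: continuous_integrable3].
- by split=> [|K cK _];
    [apply: measurable_funTS; exact: continuous_measurable3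
    |exact: continuous_integrable3].
move=> psi tpsi; have cpsi := test_function_continuous tpsi.
have cppsi := test_function_partial_continuous (i:=j) tpsi.
have [M [K [M0 cK KM KO phiK]]] := test_function_support tphi.
have dg x : derivable (phi * psi) x (Defs.basis j).
  by apply: derivableM;
    [exact: test_function_derivable tphi|exact: test_function_derivable tpsi].
have pE : partial (phi * psi) j =
    fun x => phi x * partial psi j x + psi x * partial phi j x.
  by apply/funext => x; rewrite /partial deriveM//;
    [exact: test_function_derivable tphi|exact: test_function_derivable tpsi].
have c1 : continuous (fun x => phi x * partial psi j x).
  by move=> x; apply: continuousM; [exact: cphi|exact: cppsi].
have c2 : continuous (fun x => psi x * partial phi j x).
  by move=> x; apply: continuousM; [exact: cpsi|exact: cpphi].
have cp : continuous (partial (phi * psi) j).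
  by rewrite pE => x; exact: continuousD (c1 x) (c2 x).
have g0 x : ~ box M x -> (phi * psi) x = 0.
  by move=> xM; rewrite [LHS]/GRing.mul /= phiK ?mul0r // => /KM.
have I0 := integral_partial M0 dg cp g0.
have mB := measurable_box M.
(* [Omega] is arbitrary here, perhaps not measurable; as [K] lies in both sets, the integral moves
   to the box. *)
have full (h : R3 R -> R) : (forall x, ~ K x -> h x = 0) ->
    \int[vol]_(x in Omega) h x = \int[vol]_(x in box M) h x.
  move=> h0; rewrite Rintegral_mkcond [RHS]Rintegral_mkcond.
  apply: eq_Rintegral => x _; rewrite !patchE.
  have [Kx|/h0 ->] := pselect (K x); last by do 2 case: ifP.
  by rewrite !ifT ?inE //; [exact: KM|exact: KO].
have z1 x : ~ K x -> phi x * partial psi j x = 0 by move=> /phiK ->; rewrite mul0r.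
have z2 x : ~ K x -> partial phi j x * psi x = 0.
  move=> xK.
  by rewrite (closed_partial_support _ (compact_closed3 cK) phiK xK) mul0r.
rewrite (full _ z1) (full _ z2); apply/eqP; rewrite -addr_eq0; apply/eqP.
rewrite -RintegralD//; last 2 first.
- by apply: continuous_integrable3 => //; exact: compact_box.
- under eq_fun do rewrite mulrC.
  by apply: continuous_integrable3 => //; exact: compact_box.
transitivity (\int[vol]_x partial (phi * psi) j x); last by rewrite /Rintegral I0.
rewrite Rintegral_mkcond; apply: eq_Rintegral => x _; rewrite patchE.
case: ifPn => [_|]; first by rewrite pE mulrC [X in _ + X]mulrC mulrC.
rewrite notin_setE => xM; have xK : ~ K x by move=> /KM.
by rewrite pE z1 // mulrC z2 // addr0.
Qed.

End TestFunctions.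

(** * Pointwise inequalities for the stress *)
Section Frobenius.
Context {R : realType} (m n : nat).
Implicit Types A B C : 'M[R]_(m, n).

Lemma ddotC A B : ddot A B = ddot B A.
Proof. by apply: eq_bigr => i _; apply: eq_bigr => j _; rewrite mulrC. Qed.

Lemma ddotDl A B C : ddot (A + B) C = ddot A C + ddot B C.
Proof.
rewrite /ddot -big_split; apply: eq_bigr => i _ /=.
by rewrite -big_split; apply: eq_bigr => j _ /=; rewrite mxE mulrDl.
Qed.

Lemma ddotZl (k : R) A B : ddot (k *: A) B = k * ddot A B.
Proof.
rewrite /ddot mulr_sumr; apply: eq_bigr => i _ /=.
by rewrite mulr_sumr; apply: eq_bigr => j _ /=; rewrite mxE mulrA.
Qed.

Lemma ddotDr A B C : ddot C (A + B) = ddot C A + ddot C B.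
Proof. by rewrite ddotC ddotDl !(ddotC C). Qed.

Lemma ddotZr (k : R) A B : ddot A (k *: B) = k * ddot A B.
Proof. by rewrite ddotC ddotZl ddotC. Qed.

Lemma ddotNl A B : ddot (- A) B = - ddot A B.
Proof. by rewrite -scaleN1r ddotZl mulN1r. Qed.

Lemma ddotNr A B : ddot A (- B) = - ddot A B.
Proof. by rewrite -scaleN1r ddotZr mulN1r. Qed.

Lemma ddotBl A B C : ddot (A - B) C = ddot A C - ddot B C.
Proof. by rewrite ddotDl ddotNl. Qed.

Lemma ddotBr A B C : ddot C (A - B) = ddot C A - ddot C B.
Proof. by rewrite ddotDr ddotNr. Qed.

Lemma ddot_ge0 A : 0 <= ddot A A.
Proof. by apply: sumr_ge0 => i _; apply: sumr_ge0 => j _; exact: sqr_ge0. Qed.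

Lemma fro_ge0 A : 0 <= fro A. Proof. exact: sqrtr_ge0. Qed.

Lemma fro_sqr A : fro A ^+ 2 = ddot A A.
Proof. by rewrite sqr_sqrtr // ddot_ge0. Qed.

(** The quadratic polynomial [H] in [t] is the squared norm of A + t B, hence never negative. *)
Lemma ddot_cauchy_schwarz A B : `|ddot A B| <= fro A * fro B.
Proof.
rewrite -(@ler_pXn2r _ 2) ?nnegrE ?mulr_ge0 ?fro_ge0 //.
rewrite exprMn !fro_sqr real_normK ?num_real //.
have H t : 0 <= ddot A A + 2 * t * ddot A B + t ^+ 2 * ddot B B.
  have := ddot_ge0 (A + t *: B).
  rewrite ddotDl !ddotDr !ddotZl !ddotZr (ddotC B A); congr (_ <= _); ring.
have aa := ddot_ge0 A; have := ddot_ge0 B; rewrite le_eqVlt => /predU1P[b0|b0].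
  have [->|ab0] := eqVneq (ddot A B) 0; first by rewrite expr0n mulr_ge0 ?ddot_ge0.
  (* With vanishing leading coefficient the polynomial is affine in [t]; this [t] gives it the value
     -1, a contradiction. *)
  have := H (- (ddot A A + 1) / (2 * ddot A B)); rewrite -b0 mulr0 addr0.
  have -> : ddot A A + 2 * (- (ddot A A + 1) / (2 * ddot A B)) * ddot A B = -1.
    by field.
  by rewrite ler0N1.
(* The minimiser of the polynomial. *)
have := H (- ddot A B / ddot B B).
have -> : ddot A A + 2 * (- ddot A B / ddot B B) * ddot A B +
    (- ddot A B / ddot B B) ^+ 2 * ddot B B = ddot A A - ddot A B ^+ 2 / ddot B B.
  by field; rewrite gt_eqF.
by rewrite subr_ge0 ler_pdivrMr.
Qed.

Lemma fro_triangle A B : fro (A + B) <= fro A + fro B.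
Proof.
rewrite -(@ler_pXn2r _ 2) ?nnegrE ?addr_ge0 ?fro_ge0 // fro_sqr.
rewrite ddotDl !ddotDr (ddotC B A) sqrrD !fro_sqr.
have := le_trans (ler_norm _) (ddot_cauchy_schwarz A B); lra.
Qed.

Lemma froN A : fro (- A) = fro A.
Proof. by rewrite /fro ddotNl ddotNr opprK. Qed.

Lemma fro_sub A B : fro (A - B) <= fro A + fro B.
Proof. by rewrite -(froN B) fro_triangle. Qed.

Lemma fro_scale (k : R) A : fro (k *: A) = `|k| * fro A.
Proof.
by rewrite /fro ddotZl ddotZr mulrA -expr2 sqrtrM ?sqr_ge0 // sqrtr_sqr.
Qed.

Lemma fro0 : fro (0 : 'M[R]_(m, n)) = 0.
Proof. by rewrite -(scale0r 0) fro_scale normr0 mul0r. Qed.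

Lemma entry_le_fro A i j : `|A i j| <= fro A.
Proof.
rewrite -(@ler_pXn2r _ 2) ?nnegrE ?fro_ge0 // fro_sqr real_normK ?num_real //.
rewrite /ddot (bigD1 i) //= (bigD1 j) //= -addrA -expr2 lerDl.
by rewrite addr_ge0 ?sumr_ge0 // => k _; rewrite ?sumr_ge0 // => *; exact: sqr_ge0.
Qed.

Lemma fro_le_sum A : fro A <= \sum_i \sum_j `|A i j|.
Proof.
have S0 : 0 <= \sum_i \sum_j `|A i j| by do 2 (apply: sumr_ge0 => ? _).
rewrite -(@ler_pXn2r _ 2) ?nnegrE ?fro_ge0 // fro_sqr expr2 mulr_suml.
apply: ler_sum => i _; rewrite mulr_suml; apply: ler_sum => j _.
rewrite -expr2 -(real_normK (num_real _)) expr2 ler_wpM2l //.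
rewrite (bigD1 i) //= (bigD1 j) //= -addrA lerDl.
by rewrite addr_ge0 ?sumr_ge0 // => k _; rewrite ?sumr_ge0.
Qed.

End Frobenius.

Section PowerInequalities.
Context {R : realType}.
Implicit Types x y p q : R.

Lemma bernoulli_le (n : nat) (t : R) : 0 <= t <= 1 -> 1 - t ^+ n <= n%:R * (1 - t).
Proof.
move=> /andP[t0 t1]; elim: n => [|n IH]; first by rewrite expr0 subrr mul0r.
have tn : t ^+ n <= 1 by exact: exprn_ile1.
rewrite exprS -natr1; have := ler_wpM2l t0 IH.
have : 0 <= n%:R * (1 - t) * (1 - t) by rewrite !mulr_ge0 ?subr_ge0.
nra.
Qed.

(** Plays the part of the mean value theorem without differentiating real powers. By homogeneity it
    concerns t = y / x in (0, 1], where t^n <= t^p for the natural bound [n] of the exponent, and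
    Bernoulli's inequality applies to t^n. *)
Lemma powR_diff_mul_le (n : nat) p x y : 0 <= p -> p <= n%:R -> 0 <= y -> y <= x ->
  (x `^ p - y `^ p) * y <= n%:R * x `^ p * (x - y).
Proof.
move=> p0 pn y0 yx; have x0 := le_trans y0 yx.
move: (y0); rewrite le_eqVlt => /predU1P[<-|y_gt0].
  by rewrite mulr0 mulr_ge0 ?mulr_ge0 ?powR_ge0 ?subr0.
have x_gt0 := lt_le_trans y_gt0 yx.
pose t := y / x; have yE : y = x * t by rewrite /t mulrC divfK ?gt_eqF.
have t0 : 0 < t by rewrite divr_gt0.
have t1 : t <= 1 by rewrite ler_pdivrMr // mul1r.
have tp : t ^+ n <= t `^ p.
  rewrite -powR_mulrn ?(ltW t0) //.
  by have /ger_powR h : 0 < t <= 1 by [rewrite t0]; exact: h.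
have H1 : 1 - t `^ p <= n%:R * (1 - t).
  apply: le_trans (bernoulli_le n _); last by rewrite ltW.
  by rewrite lerB.
have yp : y `^ p = x `^ p * t `^ p by rewrite yE powRM ?ltW.
rewrite yp -{1}[x `^ p]mulr1 -mulrBr -mulrA -mulrA [X in _ <= X]mulrCA.
rewrite ler_wpM2l ?powR_ge0 //.
have -> : x - y = x * (1 - t) by rewrite mulrBr mulr1 -yE.
have tx : x * t <= x by rewrite -yE.
have tp1 : t `^ p <= 1.
  apply: (@le_trans _ _ (1 `^ p)); last by rewrite powR1.
  by rewrite ge0_ler_powR // nnegrE ltW.
apply: (@le_trans _ _ ((1 - t `^ p) * x)); first by rewrite ler_wpM2l // subr_ge0.
by rewrite [X in _ <= X]mulrCA mulrC ler_wpM2l // ltW.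
Qed.

Lemma powR_sub2_sqr q x : 2 <= q -> 0 <= x -> x `^ (q - 2) * x ^+ 2 = x `^ q.
Proof.
move=> q2; rewrite le_eqVlt => /predU1P[<-|x0].
  (* At zero the power with exponent q - 2 equals 1 if q = 2, but the square annihilates the
     product. *)
  by rewrite expr0n mulr0 powR0 // gt_eqF //; lra.
rewrite -powR_mulrn ?ltW // -powRD ?subrK //.
by apply/implyP => _; rewrite gt_eqF.
Qed.

Lemma powR_sub1_mul q x : 1 <= q -> 0 <= x -> x `^ (q - 1) * x = x `^ q.
Proof. by move=> q1 x0; rewrite mulrC mulr_powRB1 //; lra. Qed.

(** The product is at most the q-th power of the larger of [x] and [y], so no exponent-dependent
    constant appears. *)
Lemma young_sqr q x y : 2 <= q -> 0 <= x -> 0 <= y ->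
  x `^ (q - 2) * y ^+ 2 <= x `^ q + y `^ q.
Proof.
move=> q2 x0 y0; have [yx|/ltW xy] := leP y x.
  rewrite -[leLHS]addr0 lerD ?powR_ge0 // -(powR_sub2_sqr q2 x0).
  by rewrite ler_wpM2l ?powR_ge0 // ler_pXn2r ?nnegrE.
rewrite -[leLHS]add0r lerD ?powR_ge0 // -(powR_sub2_sqr q2 y0).
by rewrite ler_wpM2r ?sqr_ge0 // ge0_ler_powR ?nnegrE // subr_ge0.
Qed.

(** If y <= K x the second summand suffices. Otherwise x <= y / K, and K^(q-1) >= K because q - 1 >=
    1. *)
Lemma young_small q K x y : 2 <= q -> 1 <= K -> 0 <= x -> 0 <= y ->
  x `^ (q - 1) * y <= y `^ q / K + K * x `^ q.
Proof.
move=> q2 K1 x0 y0; have q1 : 1 <= q by lra.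
have K0 : 0 < K by exact: lt_le_trans K1.
have [yx|/ltW xy] := leP y (K * x).
  rewrite -[leLHS]add0r; apply: lerD; first by rewrite divr_ge0 ?powR_ge0 ?(ltW K0).
  rewrite -(powR_sub1_mul q1 x0) [leRHS]mulrCA ler_wpM2l ?powR_ge0 //.
rewrite -[leLHS]addr0; apply: lerD; last by rewrite mulr_ge0 ?powR_ge0 ?(ltW K0).
rewrite -(powR_sub1_mul q1 y0) mulrAC ler_wpM2r //.
have xyK : x <= y / K by rewrite ler_pdivlMr // mulrC.
apply: (@le_trans _ _ ((y / K) `^ (q - 1))).
  by rewrite ge0_ler_powR ?nnegrE ?divr_ge0 ?(ltW K0) //; lra.
rewrite powRM ?invr_ge0 ?(ltW K0) // ler_wpM2l ?powR_ge0 //.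
by apply: ge1r_powR; [rewrite invr_gt0 K0 invf_le1|lra].
Qed.

End PowerInequalities.

Section FluxInequalities.
Context {R : realType} (k : nat).
Implicit Types (A B E : 'M[R]_k) (q mu om s : R).

(** With a = |A|^(q-2) and b = |B|^(q-2), the right-hand side equals (a + b) |A - B|^2 / 2 + (a - b)
    (|A|^2 - |B|^2) / 2, whose last term is nonnegative since the power is monotone. *)
Lemma flux_monotone q A B : 2 <= q ->
  (fro A `^ (q - 2) + fro B `^ (q - 2)) * fro (A - B) ^+ 2 / 2 <=
  ddot (fro A `^ (q - 2) *: A - fro B `^ (q - 2) *: B) (A - B).
Proof.
move=> q2; set a := fro A `^ _; set b := fro B `^ _.
have ab : 0 <= (a - b) * (ddot A A - ddot B B).
  rewrite -!fro_sqr subr_sqr mulrA mulr_ge0 ?addr_ge0 ?fro_ge0 //.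
  have p0 : 0 <= q - 2 by rewrite subr_ge0.
  have [AB|/ltW BA] := leP (fro A) (fro B).
    by rewrite mulr_le0 // subr_le0 // ge0_ler_powR // nnegrE fro_ge0.
  by rewrite mulr_ge0 // subr_ge0 // ge0_ler_powR // nnegrE fro_ge0.
rewrite fro_sqr !ddotBl !ddotBr !ddotZl (ddotC B A); lra.
Qed.

(** For |B| <= |A| the difference is a (A - B) + (a - b) B. The first part costs the factor 1, the
    second, by [powR_diff_mul_le], the factor [n]. *)
Lemma flux_lipschitz (n : nat) q A B : 2 <= q -> q - 2 <= n%:R ->
  fro (fro A `^ (q - 2) *: A - fro B `^ (q - 2) *: B) <=
  n.+1%:R * (fro A `^ (q - 2) + fro B `^ (q - 2)) * fro (A - B).
Proof.
move=> q2 qn; have p0 : 0 <= q - 2 by rewrite subr_ge0.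
wlog BA : A B / fro B <= fro A.
  move=> H; have [/H//|/ltW AB] := leP (fro B) (fro A).
  have := H _ _ AB; rewrite -[X in fro X <= _]opprB froN.
  by rewrite -[B - A]opprB froN [fro B `^ _ + _]addrC.
set a := fro A `^ _; set b := fro B `^ _; set d := fro (A - B).
have ba : b <= a by rewrite ge0_ler_powR ?nnegrE ?fro_ge0.
have -> : a *: A - b *: B = a *: (A - B) + (a - b) *: B.
  by rewrite scalerBr scalerBl addrA subrK.
apply: le_trans (fro_triangle _ _) _.
rewrite !fro_scale ger0_norm ?powR_ge0 // ger0_norm ?subr_ge0 // -/d.
have h1 : (a - b) * fro B <= n%:R * a * (fro A - fro B).
  by apply: powR_diff_mul_le => //; exact: fro_ge0.
have h2 : n%:R * a * (fro A - fro B) <= n%:R * a * d.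
  rewrite ler_wpM2l ?mulr_ge0 ?powR_ge0 // lerBlDr.
  by rewrite -{1}(subrK B A) fro_triangle.
have h3 : 0 <= n.+1%:R * b * d by rewrite !mulr_ge0 ?powR_ge0 ?fro_ge0.
rewrite [n.+1%:R * (a + b)]mulrDr mulrDl; move: h3; rewrite -natr1; lra.
Qed.

(** |A - B| is at most twice the larger of |A| and |B|; this is raised to the power q - 2 only,
    leaving a square. *)
Lemma powR_fro_sub_le q A B : 2 <= q ->
  fro (A - B) `^ q <=
  2 `^ (q - 2) * ((fro A `^ (q - 2) + fro B `^ (q - 2)) * fro (A - B) ^+ 2).
Proof.
move=> q2; have p0 : 0 <= q - 2 by rewrite subr_ge0.
rewrite -(powR_sub2_sqr q2) ?fro_ge0 // mulrA ler_wpM2r ?sqr_ge0 //.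
have H (x y : R) : 0 <= x -> x <= y -> fro (A - B) <= x + y ->
    fro (A - B) `^ (q - 2) <= 2 `^ (q - 2) * y `^ (q - 2).
  move=> x0 xy dxy; have y0 := le_trans x0 xy.
  by rewrite -powRM // ge0_ler_powR // ?nnegrE ?mulr_ge0 ?fro_ge0 //; lra.
have c0 : 0 <= 2 `^ (q - 2) :> R by exact: powR_ge0.
have [AB|/ltW BA] := leP (fro A) (fro B).
  apply: le_trans (H _ _ (fro_ge0 A) AB (fro_sub _ _)) _.
  by rewrite ler_wpM2l // lerDr powR_ge0.
have := fro_sub A B; rewrite [fro A + _]addrC => dBA.
apply: le_trans (H _ _ (fro_ge0 B) BA dBA) _.
by rewrite ler_wpM2l // lerDl powR_ge0.
Qed.

(* The mixed term [2 w (F(A) - F(B)) : E] is absorbed by monotonicity, which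
   leaves [w (|A|^(q-2) + |B|^(q-2)) |E|^2]; Young with the free scale [s]
   then turns this into [s^2] times a quantity bounded by the energies. *)
Lemma error_pointwise (n : nat) mu q om s A B E :
  0 <= mu -> 2 <= q -> q - 2 <= n%:R -> 0 <= om -> 0 < s ->
  mu * fro (A - B) ^+ 2 + (2 * 2 `^ (q - 2))^-1 * (om * fro (A - B) `^ q) <=
  ddot ((2 * (mu + om * fro A `^ (q - 2))) *: A
        - (2 * (mu + om * fro B `^ (q - 2))) *: B - (2 * mu) *: E)
       (A - B - E)
  + 2 * mu * fro E ^+ 2
  + 2 * n.+1%:R ^+ 2 * s ^+ 2 *
    (om * fro A `^ q + om * fro B `^ q + 2 * (om * fro E `^ q) / s `^ q).
Proof.
move=> mu0 q2 qn om0 s0.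
set a := fro A `^ (q - 2); set b := fro B `^ (q - 2).
pose D := a *: A - b *: B; pose d := fro (A - B); pose e := fro E.
have [a0 b0 d0 e0] : [/\ 0 <= a, 0 <= b, 0 <= d & 0 <= e].
  by rewrite !powR_ge0 !fro_ge0.
pose K : R := n.+1%:R; have K0 : 0 <= K by rewrite ler0n.
(* The Stokes projection contributes [(2 * mu) *: E], which completes the viscous part to a multiple
   of the test matrix A - B - E itself. *)
have -> : ddot ((2 * (mu + om * a)) *: A - (2 * (mu + om * b)) *: B
                - (2 * mu) *: E) (A - B - E) =
    2 * mu * fro (A - B - E) ^+ 2 + 2 * om * (ddot D (A - B) - ddot D E).
  rewrite fro_sqr /D !ddotBl !ddotBr !ddotZl.
  by rewrite (ddotC B A) (ddotC E A) (ddotC E B); ring.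
have hmon : (a + b) * d ^+ 2 / 2 <= ddot D (A - B) by exact: flux_monotone.
have hlip : ddot D E <= K * (a + b) * d * e.
  apply: le_trans (ler_norm _) _; apply: le_trans (ddot_cauchy_schwarz _ _) _.
  by rewrite ler_wpM2r //; exact: flux_lipschitz.
have hq : (2 * 2 `^ (q - 2))^-1 * d `^ q <= (a + b) * d ^+ 2 / 2.
  have c0 : 0 < 2 `^ (q - 2) :> R by rewrite powR_gt0.
  have -> : (a + b) * d ^+ 2 / 2 =
      (2 * 2 `^ (q - 2))^-1 * (2 `^ (q - 2) * ((a + b) * d ^+ 2)).
    by field; rewrite gt_eqF.
  by rewrite ler_wpM2l ?invr_ge0 ?mulr_ge0 ?(ltW c0) //; exact: powR_fro_sub_le.
have hV : d ^+ 2 <= 2 * fro (A - B - E) ^+ 2 + 2 * e ^+ 2.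
  have dV : d <= fro (A - B - E) + e.
    by have := fro_triangle (A - B - E) E; rewrite subrK.
  apply: (@le_trans _ _ ((fro (A - B - E) + e) ^+ 2)).
    by rewrite ler_pXn2r ?nnegrE ?addr_ge0 ?fro_ge0.
  have := sqr_ge0 (fro (A - B - E) - e); rewrite sqrrB sqrrD; lra.
have hY (x : R) : 0 <= x -> x `^ (q - 2) * e ^+ 2 <=
    s ^+ 2 * (x `^ q + e `^ q / s `^ q).
  move=> x0; have se : 0 <= e / s by rewrite divr_ge0 // ltW.
  have := young_sqr q2 x0 se.
  rewrite [(e / s) `^ q]powRM ?invr_ge0 ?(ltW s0) //.
  have -> : s^-1 `^ q = (s `^ q)^-1.
    by rewrite -[s^-1]powR_inv1 ?(ltW s0) // -powRrM mulN1r powRN.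
  rewrite expr_div_n mulrA ler_pdivrMr ?exprn_gt0 // => H.
  by rewrite [leRHS]mulrC.
have hE : (a + b) * e ^+ 2 <=
    s ^+ 2 * (fro A `^ q + fro B `^ q + 2 * e `^ q / s `^ q).
  have := hY _ (fro_ge0 A); have := hY _ (fro_ge0 B); rewrite -/a -/b; clear; lra.
(* Twice [hmon] supplies (a + b) d^2: one half absorbs this mixed term, the other yields the q-th
   power on the left through [hq]. *)
have hAbs : 2 * K * (a + b) * d * e <=
    (a + b) * d ^+ 2 / 2 + 2 * K ^+ 2 * ((a + b) * e ^+ 2).
  have : 0 <= (a + b) * (d - 2 * K * e) ^+ 2 by rewrite mulr_ge0 ?addr_ge0 ?sqr_ge0.
  rewrite sqrrB; clear; lra.
have hfin : (2 * 2 `^ (q - 2))^-1 * d `^ q <= 2 * (ddot D (A - B) - ddot D E)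
    + 2 * K ^+ 2 * (s ^+ 2 * (fro A `^ q + fro B `^ q + 2 * e `^ q / s `^ q)).
  have K2 : 0 <= 2 * K ^+ 2 by rewrite mulr_ge0 ?sqr_ge0.
  move: hmon hlip hq hAbs (ler_wpM2l K2 hE); clear; lra.
have := ler_wpM2l om0 hfin; have := ler_wpM2l mu0 hV.
rewrite -/K -/d -/e; clear; lra.
Qed.

End FluxInequalities.

(** * Integrability on the domain *)
Section AlmostEverywhere.
Context d (T : measurableType d) (R : realType).
Variables (mu : {measure set T -> \bar R}) (D : set T).
Hypothesis mD : measurable D.
Implicit Types f g : T -> R.
Local Notation intg f := (mu.-integrable D (EFin \o f)).

Lemma ae_mono (P Q : T -> Prop) : {ae mu, forall x, P x} ->
  (forall x, P x -> Q x) -> {ae mu, forall x, Q x}.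
Proof. by move=> aeP PQ; apply: filterS aeP. Qed.

Lemma ae_mono2 (P1 P2 Q : T -> Prop) : {ae mu, forall x, P1 x} ->
  {ae mu, forall x, P2 x} -> (forall x, P1 x -> P2 x -> Q x) ->
  {ae mu, forall x, Q x}.
Proof. by move=> aeP1 aeP2 PQ; apply: filterS2 aeP1 aeP2. Qed.

Lemma integrable_measurable_fun f : intg f -> measurable_fun D f.
Proof. by move=> /measurable_int /measurable_EFinP. Qed.

Lemma integrable_EFinD f g : intg f -> intg g -> intg (fun x => f x + g x).
Proof. by move=> f1 g1; exact: (integrableD mD f1 g1). Qed.

Lemma integrable_EFinB f g : intg f -> intg g -> intg (fun x => f x - g x).
Proof. by move=> f1 g1; exact: (integrableB mD f1 g1). Qed.

Lemma integrable_EFinZ (k : R) f : intg f -> intg (fun x => k * f x).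
Proof. by move=> f1; exact: (integrableZl mD k f1). Qed.

Lemma integrable_EFin_sum (I : Type) (s : seq I) (F : I -> T -> R) :
  (forall i, intg (F i)) -> intg (fun x => \sum_(i <- s) F i x).
Proof.
move=> HF; elim: s => [|i s IH].
  by under eq_fun do rewrite big_nil; exact: integrable0.
by under eq_fun do rewrite big_cons; exact: integrable_EFinD.
Qed.

Lemma Rintegral_sum (I : Type) (s : seq I) (F : I -> T -> R) :
  (forall i, intg (F i)) ->
  \int[mu]_(x in D) (\sum_(i <- s) F i x) = \sum_(i <- s) \int[mu]_(x in D) F i x.
Proof.
move=> HF; elim: s => [|i s IH].
  rewrite big_nil; under eq_Rintegral do rewrite big_nil.
  by rewrite Rintegral_cst // mul0r.
rewrite big_cons -IH -RintegralD //; last exact: integrable_EFin_sum.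
by apply: eq_Rintegral => x _; rewrite big_cons.
Qed.

Lemma ae_le_integrable f g : measurable_fun D f ->
  {ae mu, forall x, D x -> `|f x| <= g x} -> intg g -> intg f.
Proof.
move=> mf fg /integrableP[mg gfin]; apply/integrableP; split.
  exact/measurable_EFinP.
apply: le_lt_trans gfin; apply: ae_ge0_le_integral => //.
- by apply: measurableT_comp => //; exact/measurable_EFinP.
- by apply: measurableT_comp => //.
- apply: filterS fg => x fg Dx /=; rewrite lee_fin.
  by apply: le_trans (ler_norm _); exact: fg.
Qed.

Lemma ae_le_Rintegral f g : intg f -> intg g ->
  {ae mu, forall x, D x -> f x <= g x} ->
  \int[mu]_(x in D) f x <= \int[mu]_(x in D) g x.
Proof.
move=> f1 g1 fg; rewrite -subr_ge0 -RintegralB //.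
have mgf := integrable_measurable_fun (integrable_EFinB g1 f1).
(* The difference is nonnegative only almost everywhere; its absolute value is so at every point. *)
rewrite /Rintegral (ae_eq_integral (fun x => `|g x - f x|%:E)) //.
- by apply: Rintegral_ge0.
- exact/measurable_EFinP.
- by apply/measurable_EFinP; exact: measurableT_comp.
- by apply: filterS fg => x fg Dx; rewrite ger0_norm // subr_ge0 fg.
Qed.

Lemma ae_ge0_integrable g : measurable_fun D g ->
  {ae mu, forall x, D x -> 0 <= g x} ->
  intg g <-> (\int[mu]_(x in D) (g x)%:E < +oo)%E.
Proof.
move=> mg g0; split=> [/integrableP[_]|gfin].
  apply: le_lt_trans; apply: le_trans (lee_abs _) _.
  by apply: le_abse_integral => //; exact/measurable_EFinP.
apply/integrableP; split; first exact/measurable_EFinP.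
rewrite (ae_eq_integral (fun x => (g x)%:E)) //.
- by apply: measurableT_comp => //; exact/measurable_EFinP.
- exact/measurable_EFinP.
- by apply: filterS g0 => x gx Dx /=; rewrite ger0_norm // gx.
Qed.

Lemma ae_bounded_integrableM f g (M : R) : measurable_fun D f ->
  {ae mu, forall x, D x -> `|f x| <= M} -> intg g -> intg (fun x => f x * g x).
Proof.
move=> mf fM g1; have mg := integrable_measurable_fun g1.
apply: (@ae_le_integrable _ (fun x => M * `|g x|)).
- exact: measurable_funM.
- by apply: filterS fM => x fM Dx; rewrite normrM ler_wpM2r // fM.
- by apply: integrable_EFinZ; exact: integrable_norm.
Qed.

End AlmostEverywhere.

(** * The polyhedron: measurable, bounded, with integrable constants and weight *)

Section Domain.
Context {R : realType} (Omega : set (R3 R)).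
Hypothesis hOmega : convex_polyhedron Omega.

Lemma continuous_coord (i : 'I_3) : continuous (fun x : R3 R => Defs.coord x i).
Proof.
case: i => [[|[|[|//]]] k] /= x; rewrite /Defs.coord /=.
- apply: (@continuous_comp _ _ _ fst fst); exact: cvg_fst.
- apply: (@continuous_comp _ _ _ fst snd); [exact: cvg_fst|exact: cvg_snd].
- exact: cvg_snd.
Qed.

Lemma polyhedron_measurable : measurable (Omega : set (R3 (measurableTypeR R))).
Proof.
have [_ _ [n [a [b ->]]]] := hOmega.
have -> : [set x : R3 R | forall k, \sum_i a k i * Defs.coord x i < b k] =
    \bigcap_(k in [set: 'I_n]) [set x | \sum_i a k i * Defs.coord x i < b k].
  by apply/seteqP; split=> x /=; [move=> h k _; exact: h|move=> h k; exact: h].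
apply: (@fin_bigcap_measurable _ (R3 (measurableTypeR R))) => // k _.
apply: open_measurable3.
have -> : [set x : R3 R | \sum_i a k i * Defs.coord x i < b k] =
    (fun x : R3 R => \sum_i a k i * Defs.coord x i) @^-1` [set y | y < b k] by [].
apply: open_comp; last exact: open_lt.
move=> x _; rewrite unlock.
elim: (index_enum _) => [|i s IH] /=; first exact: cvg_cst.
apply: continuousD IH; apply: continuousM; first exact: cst_continuous.
exact: continuous_coord.
Qed.

Lemma polyhedron_subset_box : exists M : R, Omega `<=` box M.
Proof.
have [_ /ex_strict_bound_gt0[M M0 OM] _] := hOmega.
exists M => x Ox; have := OM x Ox => /= /ltW; case: x {Ox} => [[a b] c] /=.
rewrite /Num.norm /= !ge_max => /andP[/andP[h1 h2] h3].
by split; [split|] => /=; rewrite in_itv /= -ler_norml.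
Qed.

Lemma polyhedron_integrable_cst (k : R) : vol.-integrable Omega (EFin \o cst k).
Proof.
have mO := polyhedron_measurable.
have [M OM] := polyhedron_subset_box; apply: measurable_bounded_integrable => //.
- apply: le_lt_trans (vol_box M); apply: le_measure; rewrite ?inE //.
  exact: measurable_box.
- exists `|k|; split; first exact: num_real.
  by move=> C kC x _ /=; exact: ltW.
Qed.

Variable w : R3 R -> R.
Hypothesis hw : weight w.

(** Local integrability speaks of compact sets, hence the detour through a closed box around
    [Omega]. *)
Lemma weight_integrable : vol.-integrable Omega (EFin \o w).
Proof.
have [M OM] := polyhedron_subset_box; have [_ _ wl] := hw.
have wB := wl _ (@compact_box R M).
exact: (integrableS (measurable_box M) polyhedron_measurable OM wB).
Qed.

End Domain.

Section ConjugateYoung.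
Context {R : realType}.
Implicit Types q K z y w : R.

(* With [x = (z / w)^(1/(q-1))] one has [z = w x^(q-1)], and [z^q' w'] is
   [w x^q]. *)
Lemma young_conj q K z y w : 2 <= q -> 1 <= K -> 0 <= z -> 0 <= y -> 0 < w ->
  z * y <= w * y `^ q / K + K * (z `^ (conj_exp q) * w `^ (1 - q)^-1).
Proof.
move=> q2 K1 z0 y0 w0; have q1 : 0 < q - 1 by lra.
pose x := (z / w) `^ (q - 1)^-1.
have zw0 : 0 <= z / w by rewrite divr_ge0 // ltW.
have xq : x `^ (q - 1) = z / w.
  by rewrite /x -powRrM mulVf ?powRr1 // gt_eqF.
have xqw : w * x `^ q = z `^ (conj_exp q) * w `^ (1 - q)^-1.
  rewrite /x -powRrM powRM ?invr_ge0 ?(ltW w0) //.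
  have -> : (q - 1)^-1 * q = conj_exp q by rewrite mulrC.
  rewrite mulrCA; congr (_ * _).
  (* The exponents of [w] match because 1 - q / (q - 1) = 1 / (1 - q). *)
  rewrite -[w^-1]powR_inv1 ?(ltW w0) // -powRrM -{1}[w]powRr1 ?(ltW w0) //.
  rewrite -powRD; last by apply/implyP => _; rewrite gt_eqF.
  congr (_ `^ _); rewrite /conj_exp -[1 - q]opprB invrN; field.
  by rewrite gt_eqF.
have := ler_wpM2l (ltW w0) (young_small q2 K1 (powR_ge0 (z / w) (q - 1)^-1) y0).
rewrite -/x xq mulrDr [w * (K * _)]mulrCA xqw !mulrA.
by rewrite [w * z]mulrC mulfK ?gt_eqF.
Qed.

End ConjugateYoung.

(** * Matrix fields, weighted norms and symmetric gradients *)

Section MeasurableMatrices.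
Context {R : realType} (Omega : set (R3 R)) (m n : nat).
Hypothesis mO : measurable (Omega : set (R3 (measurableTypeR R))).
Implicit Types F G : R3 R -> 'M[R]_(m, n).

Definition measurable_mx F := forall i j, measurable_fun Omega
  ((fun x => F x i j) : R3 (measurableTypeR R) -> R).

Definition integrable_mx F := forall i j,
  vol.-integrable Omega (EFin \o (fun x => F x i j)).

Lemma measurable_ddot F G : measurable_mx F -> measurable_mx G ->
  measurable_fun Omega ((fun x => ddot (F x) (G x)) : R3 (measurableTypeR R) -> R).
Proof.
move=> mF mG; apply: measurable_sum => i; apply: measurable_sum => j.
exact: measurable_funM.
Qed.

Lemma measurable_fro F : measurable_mx F ->
  measurable_fun Omega ((fun x => fro (F x)) : R3 (measurableTypeR R) -> R).
Proof.
move=> mF; have ms : measurable_fun setT (@Num.sqrt R).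
  by apply: continuous_measurable_fun; exact: sqrt_continuous.
exact: (measurableT_comp ms (measurable_ddot mF mF)).
Qed.

Lemma measurable_mxZ (k : R3 R -> R) F :
  measurable_fun Omega (k : R3 (measurableTypeR R) -> R) ->
  measurable_mx F -> measurable_mx (fun x => k x *: F x).
Proof.
move=> mk mF i j; under eq_fun do rewrite mxE; exact: measurable_funM.
Qed.

Lemma measurable_mxB F G : measurable_mx F -> measurable_mx G ->
  measurable_mx (fun x => F x - G x).
Proof.
move=> mF mG i j; under eq_fun do rewrite !mxE; exact: measurable_funB.
Qed.

Lemma integrable_mx_measurable F : integrable_mx F -> measurable_mx F.
Proof. by move=> iF i j; exact: integrable_measurable_fun (iF i j). Qed.

Lemma integrable_mx_of_fro F (g : R3 R -> R) : measurable_mx F ->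
  {ae vol, forall x, Omega x -> fro (F x) <= g x} ->
  vol.-integrable Omega (EFin \o g) -> integrable_mx F.
Proof.
move=> mF Fg g1 i j; apply: (ae_le_integrable mO (mF i j) _ g1).
apply: (ae_mono Fg) => x h Ox; apply: le_trans (h Ox); exact: entry_le_fro.
Qed.

Lemma integrable_mxB F G : integrable_mx F -> integrable_mx G ->
  integrable_mx (fun x => F x - G x).
Proof.
by move=> iF iG i j; under eq_fun do rewrite !mxE; exact: integrable_EFinB.
Qed.

Lemma integrable_ddot F G (M : R) : integrable_mx F -> measurable_mx G ->
  {ae vol, forall x, Omega x -> fro (G x) <= M} ->
  vol.-integrable Omega (EFin \o (fun x => ddot (F x) (G x))).
Proof.
move=> iF mG GM; apply: integrable_EFin_sum => // i.
apply: integrable_EFin_sum => // j; under eq_fun do rewrite mulrC.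
apply: (ae_bounded_integrableM mO (mG i j) _ (iF i j) (M := M)).
by apply: (ae_mono GM) => x h Ox; apply: le_trans (h Ox); exact: entry_le_fro.
Qed.

(** The weak-* convergence in [in_W1inf0] is stated entry by entry with the gradient as first
    factor; the pairing is brought into that shape. *)
Lemma Rintegral_ddot F G (M : R) : integrable_mx F -> measurable_mx G ->
  {ae vol, forall x, Omega x -> fro (G x) <= M} ->
  \int[vol]_(x in Omega) ddot (F x) (G x) =
  \sum_i \sum_j \int[vol]_(x in Omega) (G x i j * F x i j).
Proof.
move=> iF mG GM.
have iFG i j : vol.-integrable Omega (EFin \o (fun x => G x i j * F x i j)).
  apply: (ae_bounded_integrableM mO (mG i j) _ (iF i j) (M := M)).
  by apply: (ae_mono GM) => x h Ox; apply: le_trans (h Ox); exact: entry_le_fro.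
rewrite /ddot; under eq_Rintegral do under eq_bigr do under eq_bigr do rewrite mulrC.
rewrite Rintegral_sum //; last by move=> i; exact: integrable_EFin_sum.
by apply: eq_bigr => i _; rewrite Rintegral_sum.
Qed.

End MeasurableMatrices.

Section WeightedLebesgue.
Context {R : realType} (Omega : set (R3 R)).
Hypothesis mO : measurable (Omega : set (R3 (measurableTypeR R))).
Variable w : R3 R -> R.
Hypothesis mw : measurable_fun setT (w : R3 (measurableTypeR R) -> R).
Hypothesis w0 : {ae vol, forall x, 0 <= w x}.
Implicit Types (f : R3 R -> R) (q : R).

Lemma measurable_powR_weight q f :
  measurable_fun Omega (f : R3 (measurableTypeR R) -> R) ->
  measurable_fun Omega ((fun x => `|f x| `^ q * w x) : R3 (measurableTypeR R) -> R).
Proof.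
move=> mf; apply: measurable_funM; last exact: measurable_funTS.
have mn : measurable_fun Omega ((fun x => `|f x|) : R3 (measurableTypeR R) -> R).
  exact: measurableT_comp.
exact: (measurableT_comp (measurable_powR q) mn).
Qed.

Lemma in_Lq_integrable q f : in_Lq Omega q w f <->
  measurable_fun Omega (f : R3 (measurableTypeR R) -> R) /\
  vol.-integrable Omega (EFin \o (fun x => `|f x| `^ q * w x)).
Proof.
have w0' : {ae vol, forall x, Omega x -> 0 <= `|f x| `^ q * w x}.
  by apply: (ae_mono w0) => x wx _; rewrite mulr_ge0 ?powR_ge0.
by split=> -[mf If]; split => //;
  apply/(ae_ge0_integrable mO (measurable_powR_weight q mf) w0').
Qed.

Lemma Rintegral_weight_ge0 q f : in_Lq Omega q w f ->
  0 <= \int[vol]_(x in Omega) (`|f x| `^ q * w x).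
Proof.
move=> /in_Lq_integrable[mf If].
have i0 : vol.-integrable Omega (EFin \o (fun=> 0 : R)) by exact: integrable0.
have := ae_le_Rintegral mO i0 If; rewrite Rintegral_cst // mul0r; apply.
by apply: (ae_mono w0) => x wx _; rewrite mulr_ge0 ?powR_ge0.
Qed.

Lemma norm_Lq_powR q f : 0 < q -> in_Lq Omega q w f ->
  norm_Lq Omega q w f `^ q = \int[vol]_(x in Omega) (`|f x| `^ q * w x).
Proof.
move=> q0 /Rintegral_weight_ge0 I0.
by rewrite /norm_Lq -powRrM mulVf ?gt_eqF // powRr1.
Qed.

End WeightedLebesgue.

Section SymmetricPart.
Context {R : realType}.
Implicit Types (S G : 'M[R]_3).

Lemma ddot_tr (A B : 'M[R]_3) : ddot A^T B^T = ddot A B.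
Proof.
rewrite /ddot exchange_big /=; apply: eq_bigr => i _; apply: eq_bigr => j _.
by rewrite !mxE.
Qed.

Lemma fro_tr (A : 'M[R]_3) : fro A^T = fro A.
Proof. by rewrite /fro ddot_tr. Qed.

Lemma ddot_scalar_mx (k : R) G : ddot (k *: 1%:M) G = k * \tr G.
Proof.
rewrite ddotZl /ddot /mxtrace; congr (_ * _); apply: eq_bigr => i _.
rewrite (bigD1 i) //= big1 => [|j /negbTE ji]; rewrite !mxE ?eqxx ?mul1r ?addr0 //.
by rewrite eq_sym ji mul0r.
Qed.

Lemma ddot_symr S G : S^T = S -> ddot S (2^-1 *: (G + G^T)) = ddot S G.
Proof.
by move=> St; rewrite ddotZr ddotDr -{2}St ddot_tr; lra.
Qed.

Lemma fro_sym_le G : fro (2^-1 *: (G + G^T)) <= fro G.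
Proof.
rewrite fro_scale ger0_norm ?invr_ge0 //.
by have := fro_triangle G G^T; rewrite fro_tr; lra.
Qed.

Lemma mxtrace_sym G : \tr (2^-1 *: (G + G^T)) = \tr G.
Proof. by rewrite linearZ linearD /= mxtrace_tr; lra. Qed.

End SymmetricPart.

Section Fields.
Context {R : realType} {Omega : set (R3 R)}.
Implicit Types (u v : wfield Omega).

Lemma eps_tr u x : (eps u x)^T = eps u x.
Proof. by rewrite /eps linearZ linearD /= trmxK addrC. Qed.

Lemma fro_eps_le u x : fro (eps u x) <= fro (grad u x).
Proof. exact: fro_sym_le. Qed.

Lemma div_eps u x : div u x = \tr (eps u x).
Proof. by rewrite /eps mxtrace_sym. Qed.

Lemma ddot_eps_grad u v x : ddot (eps u x) (eps v x) = ddot (eps u x) (grad v x).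
Proof. exact/ddot_symr/eps_tr. Qed.

Lemma measurable_eps u : measurable_mx Omega (grad u) -> measurable_mx Omega (eps u).
Proof.
move=> mG i j; rewrite /eps.
under eq_fun do rewrite !mxE.
by apply: measurable_funM => //; exact: measurable_funD.
Qed.

Lemma test_field_weak_gradient (Phi : R3 R -> 'rV[R]_3) : test_field Omega Phi ->
  weak_gradient Omega Phi (classical_grad Phi).
Proof.
move=> tP i j.
have -> : (fun x => classical_grad Phi x i j) = partial (fun x => Phi x 0 i) j.
  by apply/funext => x; rewrite mxE.
exact: test_function_weak_partial.
Qed.

Definition test_wfield (Phi : R3 R -> 'rV[R]_3) (tP : test_field Omega Phi) :
  wfield Omega := WField (test_field_weak_gradient tP).

End Fields.

Section Energy.
Context {R : realType} {Omega : set (R3 R)}.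
Hypothesis mO : measurable (Omega : set (R3 (measurableTypeR R))).
Hypothesis iO : forall k : R, vol.-integrable Omega (EFin \o cst k).
Variable w : R3 R -> R.
Hypothesis mw : measurable_fun setT (w : R3 (measurableTypeR R) -> R).
Hypothesis w0 : {ae vol, forall x, 0 < w x}.
Hypothesis iw : vol.-integrable Omega (EFin \o w).
Implicit Types (q mu : R).

Let w0' : {ae vol, forall x, 0 <= w x}.
Proof. by apply: (ae_mono w0) => x; exact: ltW. Qed.

Lemma in_Lqt_integrable m n q (F : R3 R -> 'M[R]_(m, n)) : in_Lqt Omega q w F ->
  vol.-integrable Omega (EFin \o (fun x => fro (F x) `^ q * w x)).
Proof.
move=> [_ /(in_Lq_integrable mO mw w0')[_]]; apply: eq_integrable => // x _ /=.
by rewrite ger0_norm ?fro_ge0.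
Qed.

Lemma integrable_in_Lqt m n q (F : R3 R -> 'M[R]_(m, n)) : measurable_mx Omega F ->
  vol.-integrable Omega (EFin \o (fun x => fro (F x) `^ q * w x)) ->
  in_Lqt Omega q w F.
Proof.
move=> mF iF; split=> //; apply/(in_Lq_integrable mO mw w0'); split.
  exact: measurable_fro.
by apply: eq_integrable iF => // x _ /=; rewrite ger0_norm ?fro_ge0.
Qed.

Lemma norm_Lqt_powR m n q (F : R3 R -> 'M[R]_(m, n)) : 0 < q ->
  in_Lqt Omega q w F ->
  norm_Lqt Omega q w F `^ q = \int[vol]_(x in Omega) (fro (F x) `^ q * w x).
Proof.
move=> q0 [_ FL]; rewrite /norm_Lqt (norm_Lq_powR mO mw w0' q0 FL).
by apply: eq_Rintegral => x _; rewrite ger0_norm ?fro_ge0.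
Qed.

Lemma bounded_in_Lqt m n q M (F : R3 R -> 'M[R]_(m, n)) : 0 <= q ->
  measurable_mx Omega F -> {ae vol, forall x, Omega x -> fro (F x) <= M} ->
  in_Lqt Omega q w F.
Proof.
move=> q0 mF FM; apply: integrable_in_Lqt => //.
have mf : measurable_fun Omega
    ((fun x => fro (F x) `^ q * w x) : R3 (measurableTypeR R) -> R).
  have := measurable_powR_weight mw q (measurable_fro mF).
  by apply: eq_measurable_fun => x _; rewrite ger0_norm ?fro_ge0.
apply: (ae_le_integrable mO mf _ (integrable_EFinZ mO (M `^ q) iw)).
apply: (ae_mono2 w0' FM) => x wx FMx Ox.
have F0 := fro_ge0 (F x); have M0 := le_trans F0 (FMx Ox).
rewrite ger0_norm ?mulr_ge0 ?powR_ge0 // ler_wpM2r // ge0_ler_powR ?nnegrE //.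
exact: FMx.
Qed.

End Energy.

(** * Pointwise bounds for the stress and the energy *)

Section PointwiseEstimates.
Context {R : realType}.
Implicit Types (mu q : R) (w : R3 R -> R).

Lemma powRD_le q x y : 0 <= q -> 0 <= x -> 0 <= y ->
  (x + y) `^ q <= 2 `^ q * (x `^ q + y `^ q) :> R.
Proof.
move=> q0 x0 y0.
have H (a b : R) : 0 <= a -> a <= b -> (a + b) `^ q <= 2 `^ q * b `^ q.
  move=> a0 ab; have b0 := le_trans a0 ab.
  by rewrite -powRM // ge0_ler_powR // ?nnegrE ?addr_ge0 ?mulr_ge0 //; lra.
have [xy|/ltW yx] := leP x y.
  apply: le_trans (H _ _ x0 xy) _.
  by rewrite ler_wpM2l ?powR_ge0 // lerDr powR_ge0.
rewrite addrC; apply: le_trans (H _ _ y0 yx) _.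
by rewrite ler_wpM2l ?powR_ge0 // lerDl powR_ge0.
Qed.

Lemma fro_stress mu q w x (A : 'M[R]_3) : 2 <= q -> 0 <= mu -> 0 <= w x ->
  fro (stress mu q w x A) = 2 * (mu * fro A + w x * fro A `^ (q - 1)).
Proof.
move=> q2 mu0 wx; rewrite /stress fro_scale ger0_norm; last first.
  by rewrite mulr_ge0 // addr_ge0 // mulr_ge0 ?powR_ge0.
have -> : fro A `^ (q - 1) = fro A `^ (q - 2) * fro A; last by ring.
have [->|A0] := eqVneq (fro A) 0; first by rewrite mulr0 powR0 // gt_eqF //; lra.
rewrite -{3}[fro A]powRr1 ?fro_ge0 // -powRD; last by rewrite A0 implybT.
by congr (_ `^ _); ring.
Qed.

(** Serves twice: y = 1 makes the stress integrable, and y = |G| makes its pairing with a field [G]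
    of finite energy integrable. *)
Lemma fro_stress_mul_le mu q w x (A : 'M[R]_3) (y : R) :
  2 <= q -> 0 <= mu -> 0 <= w x -> 0 <= y ->
  fro (stress mu q w x A) * y <=
  mu * (fro A ^+ 2 + y ^+ 2) + 2 * (w x * fro A `^ q + w x * y `^ q).
Proof.
move=> q2 mu0 wx y0; rewrite fro_stress //.
have h1 : 0 <= mu * (fro A - y) ^+ 2 by rewrite mulr_ge0 ?sqr_ge0.
have := young_small q2 (lexx 1) (fro_ge0 A) y0.
rewrite divr1 mul1r => /(ler_wpM2l wx); move: h1; rewrite sqrrB; clear; lra.
Qed.

Lemma ddot_stress_self mu q w x (A : 'M[R]_3) : 2 <= q ->
  ddot (stress mu q w x A) A = 2 * mu * fro A ^+ 2 + 2 * (w x * fro A `^ q).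
Proof.
move=> q2; rewrite /stress ddotZl -fro_sqr.
rewrite -(powR_sub2_sqr q2 (fro_ge0 A)); ring.
Qed.

(** The square root of 3, the constant in the Cauchy-Schwarz bound of |tr B| by |B|. *)
Definition trace_cst : R := fro (1%:M : 'M[R]_3).

(** The self-pairing of [B] yields each energy density of [B] twice. One copy stays on the left; the
    other is split evenly between the pairing with the stress of [A] and the pressure term. What
    remains is free of [B]. *)
Lemma energy_pointwise mu q w x (A B : 'M[R]_3) (p1 p2 : R) :
  2 <= q -> 0 < mu -> 0 < w x ->
  mu * fro B ^+ 2 + w x * fro B `^ q <=
  ddot (stress mu q w x B) B - ddot (stress mu q w x A) B + (p1 + p2) * \tr B
  + (2 * mu * fro A ^+ 2 + 8 * (w x * fro A `^ q)
     + trace_cst ^+ 2 / (2 * mu) * p1 ^+ 2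
     + trace_cst * (1 + 2 * trace_cst) * (`|p2| `^ (conj_exp q) * conj_weight q w x)).
Proof.
move=> q2 mu0 wx; rewrite ddot_stress_self // -/trace_cst; set k := trace_cst.
have k0 : 0 <= k := fro_ge0 _; have Y0 := fro_ge0 B; have X0 := fro_ge0 A.
have hS : ddot (stress mu q w x A) B <=
    2 * mu * fro A ^+ 2 + mu / 2 * fro B ^+ 2
    + (w x * fro B `^ q / 2 + 8 * (w x * fro A `^ q)).
  apply: le_trans (ler_norm _) _; apply: le_trans (ddot_cauchy_schwarz _ _) _.
  rewrite fro_stress ?(ltW mu0) ?(ltW wx) //.
  have h1 : 0 <= mu / 2 * (2 * fro A - fro B) ^+ 2.
    by rewrite mulr_ge0 ?sqr_ge0 ?divr_ge0 ?(ltW mu0).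
  (* K = 4 leaves, after the factor 2 in the stress, half a copy of the density of [B] and 8 copies
     of that of [A]. *)
  have four : 1 <= 4 :> R by lra.
  have := young_small q2 four X0 Y0.
  move=> /(ler_wpM2l (ltW wx)); move: h1; rewrite sqrrB exprMn; clear; lra.
have htr : `|\tr B| <= k * fro B.
  by rewrite -[\tr B]mul1r -ddot_scalar_mx scale1r ddot_cauchy_schwarz.
have h1 : `|p1 * \tr B| <= k ^+ 2 / (2 * mu) * p1 ^+ 2 + mu / 2 * fro B ^+ 2.
  rewrite normrM; apply: (@le_trans _ _ (`|p1| * (k * fro B))).
    by rewrite ler_wpM2l.
  have : 0 <= (2 * mu)^-1 * (k * `|p1| - mu * fro B) ^+ 2.
    by rewrite mulr_ge0 ?sqr_ge0 ?invr_ge0 ?mulr_ge0 ?(ltW mu0).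
  have -> : (2 * mu)^-1 * (k * `|p1| - mu * fro B) ^+ 2 =
      k ^+ 2 / (2 * mu) * `|p1| ^+ 2 + mu / 2 * fro B ^+ 2 - `|p1| * (k * fro B).
    by field; rewrite gt_eqF.
  by rewrite real_normK ?num_real // subr_ge0.
have h2 : `|p2 * \tr B| <= w x * fro B `^ q / 2 +
    k * (1 + 2 * k) * (`|p2| `^ (conj_exp q) * conj_weight q w x).
  rewrite normrM; apply: (@le_trans _ _ (`|p2| * (k * fro B))).
    by rewrite ler_wpM2l.
  (* K = 1 + 2 k is at least 1, as Young's inequality demands, and at least 2 k, so that k / K <= 1
     / 2. *)
  have k1 : 1 <= 1 + 2 * k by lra.
  have := ler_wpM2l k0 (young_conj q2 k1 (normr_ge0 p2) Y0 wx).
  rewrite mulrCA => H; apply: le_trans H _; rewrite mulrDr mulrA lerD //.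
    rewrite mulrA ler_pdivrMr; last by lra.
    have : 0 <= w x * fro B `^ q by rewrite mulr_ge0 ?powR_ge0 ?(ltW wx).
    rewrite -mulrA; nra.
  by rewrite /conj_weight !mulrA.
have h3 : - ((p1 + p2) * \tr B) <= `|p1 * \tr B| + `|p2 * \tr B|.
  by rewrite mulrDl; apply: le_trans (ler_norm _) _; rewrite normrN ler_normD.
move: hS h1 h2 h3; clear; lra.
Qed.

End PointwiseEstimates.

Section Squares.
Context {R : realDomainType}.
Implicit Types x y : R.

Lemma sqrrD_le2 x y : (x + y) ^+ 2 <= 2 * x ^+ 2 + 2 * y ^+ 2.
Proof. have := sqr_ge0 (x - y); rewrite sqrrB sqrrD; lra. Qed.

Lemma mulr_le_sqrD x y : x * y <= x ^+ 2 + y ^+ 2.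
Proof.
have := sqr_ge0 (x - y); rewrite sqrrB.
by have := sqr_ge0 x; have := sqr_ge0 y; lra.
Qed.

Lemma normr_le_sqrD1 x : `|x| <= x ^+ 2 + 1.
Proof.
by have := mulr_le_sqrD `|x| 1; rewrite real_normK ?num_real // expr1n mulr1.
Qed.

End Squares.

Section UnitWeight.
Context {R : realType}.

Lemma measurable_unit_weight :
  measurable_fun setT (unit_weight : R3 (measurableTypeR R) -> R).
Proof. exact: measurable_cst. Qed.

Lemma unit_weight_gt0 : {ae vol, forall x, 0 < (unit_weight : R3 R -> R) x}.
Proof. by apply/aeW => x; exact: ltr01. Qed.

End UnitWeight.

(** * Fields of finite energy, sum-space pressures and their pairings *)

Section FiniteEnergy.
Context {R : realType} {Omega : set (R3 R)}.
Hypothesis mO : measurable (Omega : set (R3 (measurableTypeR R))).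
Hypothesis iO : forall k : R, vol.-integrable Omega (EFin \o cst k).
Variable w : R3 R -> R.
Hypothesis mw : measurable_fun setT (w : R3 (measurableTypeR R) -> R).
Hypothesis w0 : {ae vol, forall x, 0 < w x}.
Hypothesis iw : vol.-integrable Omega (EFin \o w).
Variables mu q : R.
Hypothesis mu0 : 0 < mu.
Hypothesis q2 : 2 <= q.
Implicit Types (F G : R3 R -> 'M[R]_3) (p : R3 R -> R) (u v : wfield Omega).
Local Notation S := (stress mu q w).
Local Notation intg f := (vol.-integrable Omega (EFin \o f)).

Let q_gt0 : 0 < q. Proof. exact: lt_le_trans q2. Qed.
Let q_ge0 : 0 <= q. Proof. exact: ltW. Qed.

(** Formulated for matrix fields rather than for [wfield]: strains of [Xq] and of W^{1,oo}_0 fall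
    under one notion, and so do their differences, with no [wfield] behind the difference. *)
Definition finite_energy F :=
  [/\ measurable_mx Omega F, intg (fun x => fro (F x) ^+ 2) &
      intg (fun x => w x * fro (F x) `^ q)].

Definition finite_pressure p := exists p1 p2 : R3 R -> R,
  [/\ measurable_fun Omega (p1 : R3 (measurableTypeR R) -> R),
      measurable_fun Omega (p2 : R3 (measurableTypeR R) -> R),
      intg (fun x => p1 x ^+ 2),
      intg (fun x => `|p2 x| `^ (conj_exp q) * conj_weight q w x) &
      forall x, Omega x -> p x = p1 x + p2 x].

Lemma measurable_energy_density F : measurable_mx Omega F ->
  measurable_fun Omega
    ((fun x => w x * fro (F x) `^ q) : R3 (measurableTypeR R) -> R).
Proof.
move=> mF; apply: measurable_funM; first exact: measurable_funTS.
exact: (measurableT_comp (measurable_powR q) (measurable_fro mF)).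
Qed.

Lemma measurable_fro_sqr F : measurable_mx Omega F ->
  measurable_fun Omega
    ((fun x => fro (F x) ^+ 2) : R3 (measurableTypeR R) -> R).
Proof. by move=> mF; apply: measurable_funX; exact: measurable_fro. Qed.

Lemma finite_energyB F G : finite_energy F -> finite_energy G ->
  finite_energy (fun x => F x - G x).
Proof.
move=> [mF F2 Fq] [mG G2 Gq]; have mFG := measurable_mxB mF mG.
split; first exact: mFG.
  apply: (ae_le_integrable mO (measurable_fro_sqr mFG) _
    (integrable_EFinD mO (integrable_EFinZ mO 2 F2) (integrable_EFinZ mO 2 G2))).
  apply/aeW => x _; rewrite ger0_norm ?sqr_ge0 //.
  apply: (@le_trans _ _ ((fro (F x) + fro (G x)) ^+ 2)).
    by rewrite ler_pXn2r ?nnegrE ?addr_ge0 ?fro_ge0 // fro_sub.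
  exact: sqrrD_le2.
apply: (ae_le_integrable mO (measurable_energy_density mFG) _
  (integrable_EFinZ mO (2 `^ q) (integrable_EFinD mO Fq Gq))).
apply: (ae_mono w0) => x wx _.
rewrite ger0_norm ?mulr_ge0 ?powR_ge0 ?(ltW wx) // -mulrDr mulrCA.
rewrite ler_wpM2l ?(ltW wx) //.
apply: le_trans (powRD_le q_ge0 (fro_ge0 _) (fro_ge0 _)).
by rewrite ge0_ler_powR // ?nnegrE ?addr_ge0 ?fro_ge0 // fro_sub.
Qed.

Lemma finite_energy_le F G : measurable_mx Omega F ->
  (forall x, fro (F x) <= fro (G x)) -> finite_energy G -> finite_energy F.
Proof.
move=> mF FG [mG G2 Gq]; split; first exact: mF.
  apply: (ae_le_integrable mO (measurable_fro_sqr mF) _ G2).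
  apply/aeW => x _; rewrite ger0_norm ?sqr_ge0 //.
  by rewrite ler_pXn2r ?nnegrE ?fro_ge0.
apply: (ae_le_integrable mO (measurable_energy_density mF) _ Gq).
apply: (ae_mono w0) => x wx _.
rewrite ger0_norm ?mulr_ge0 ?powR_ge0 ?(ltW wx) // ler_wpM2l ?(ltW wx) //.
by rewrite ge0_ler_powR // ?nnegrE ?fro_ge0.
Qed.

Lemma in_Lqt_finite_energy F :
  in_Lqt Omega 2 unit_weight F -> in_Lqt Omega q w F -> finite_energy F.
Proof.
move=> F2 Fq; split; first by case: Fq.
  have := in_Lqt_integrable mO measurable_unit_weight unit_weight_gt0 F2.
  apply: eq_integrable => // x _ /=.
  by rewrite mulr1 powR_mulrn ?fro_ge0.
have := in_Lqt_integrable mO mw w0 Fq.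
by apply: eq_integrable => // x _ /=; rewrite mulrC.
Qed.

Lemma finite_energy_in_Lqt F : finite_energy F ->
  in_Lqt Omega 2 unit_weight F /\ in_Lqt Omega q w F.
Proof.
move=> [mF F2 Fq]; split.
  apply: (integrable_in_Lqt mO measurable_unit_weight unit_weight_gt0 mF).
  by apply: eq_integrable F2 => // x _ /=; rewrite mulr1 powR_mulrn ?fro_ge0.
apply: (integrable_in_Lqt mO mw w0 mF).
by apply: eq_integrable Fq => // x _ /=; rewrite mulrC.
Qed.

Lemma norm_sqr_energy F : finite_energy F ->
  norm_Lqt Omega 2 unit_weight F ^+ 2 = \int[vol]_(x in Omega) fro (F x) ^+ 2.
Proof.
move=> /finite_energy_in_Lqt[F2 _].
rewrite -powR_mulrn ?powR_ge0 // (norm_Lqt_powR mO measurable_unit_weight unit_weight_gt0 _ F2) //.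
by apply: eq_Rintegral => x _; rewrite mulr1 powR_mulrn ?fro_ge0.
Qed.

Lemma norm_powR_energy F : finite_energy F ->
  norm_Lqt Omega q w F `^ q = \int[vol]_(x in Omega) (w x * fro (F x) `^ q).
Proof.
move=> /finite_energy_in_Lqt[_ Fq].
rewrite (norm_Lqt_powR mO mw w0 q_gt0 Fq).
by apply: eq_Rintegral => x _; rewrite mulrC.
Qed.

Lemma bounded_finite_energy F M : measurable_mx Omega F ->
  {ae vol, forall x, Omega x -> fro (F x) <= M} -> finite_energy F.
Proof.
move=> mF FM; apply: in_Lqt_finite_energy.
  have iu : vol.-integrable Omega (EFin \o unit_weight) := iO 1.
  exact: (bounded_in_Lqt mO measurable_unit_weight unit_weight_gt0 iu (ler0n R 2) mF FM).
exact: (bounded_in_Lqt mO mw w0 iw q_ge0 mF FM).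
Qed.

Lemma measurable_stress F : measurable_mx Omega F ->
  measurable_mx Omega (fun x => S x (F x)).
Proof.
move=> mF; apply: (measurable_mxZ _ mF).
apply: measurable_funM => //; apply: measurable_funD => //.
apply: measurable_funM; first exact: measurable_funTS.
exact: (measurableT_comp (measurable_powR (q - 2)) (measurable_fro mF)).
Qed.

Lemma integrable_stress F : finite_energy F ->
  integrable_mx Omega (fun x => S x (F x)).
Proof.
move=> [mF F2 Fq].
apply: (integrable_mx_of_fro mO (measurable_stress mF) (g := fun x =>
  mu * (fro (F x) ^+ 2 + 1) + 2 * (w x * fro (F x) `^ q + w x))).
  apply: (ae_mono w0) => x wx _.
  have := fro_stress_mul_le (F x) q2 (ltW mu0) (ltW wx) ler01.
  by rewrite mulr1 expr1n powR1 mulr1.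
apply: (integrable_EFinD mO); apply: (integrable_EFinZ mO).
  by apply: (integrable_EFinD mO F2); exact: iO.
exact: integrable_EFinD.
Qed.

Lemma integrable_stress_ddot F G : finite_energy F -> finite_energy G ->
  intg (fun x => ddot (S x (F x)) (G x)).
Proof.
move=> [mF F2 Fq] [mG G2 Gq].
have mSG := measurable_ddot (measurable_stress mF) mG.
apply: (ae_le_integrable mO mSG _ (integrable_EFinD mO
  (integrable_EFinZ mO mu (integrable_EFinD mO F2 G2))
  (integrable_EFinZ mO 2 (integrable_EFinD mO Fq Gq)))).
apply: (ae_mono w0) => x wx _.
apply: le_trans (ddot_cauchy_schwarz _ _) _.
exact: fro_stress_mul_le q2 (ltW mu0) (ltW wx) (fro_ge0 _).
Qed.

Lemma integrable_energy_ddot F G : finite_energy F -> finite_energy G ->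
  intg (fun x => ddot (F x) (G x)).
Proof.
move=> [mF F2 _] [mG G2 _].
apply: (ae_le_integrable mO (measurable_ddot mF mG) _ (integrable_EFinD mO F2 G2)).
apply/aeW => x _; apply: le_trans (ddot_cauchy_schwarz _ _) _.
exact: mulr_le_sqrD.
Qed.

(** Young's inequality against the constant 1: the first part is dominated by its square plus 1, the
    second by [w] plus its weighted q'-density. *)
Lemma integrable_pressure p : finite_pressure p -> intg p.
Proof.
move=> [p1 [p2 [m1 m2 i1 i2 pE]]].
have i12 : intg (fun x => p1 x + p2 x).
  apply: integrable_EFinD => //.
    apply: (ae_le_integrable mO m1 _ (integrable_EFinD mO i1 (iO 1))).
    by apply/aeW => x _; exact: normr_le_sqrD1.
  apply: (ae_le_integrable mO m2 _ (integrable_EFinD mO iw i2)).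
  apply: (ae_mono w0) => x wx _.
  have := young_conj q2 (lexx 1) (normr_ge0 (p2 x)) ler01 wx.
  by rewrite !mulr1 powR1 divr1 mulr1 mul1r.
by apply: eq_integrable i12 => // x xO /=; rewrite pE // -in_setE.
Qed.

Lemma integrable_pressure_trace p F : finite_pressure p -> finite_energy F ->
  intg (fun x => p x * \tr (F x)).
Proof.
move=> pp FF; have ip := integrable_pressure pp.
have mp := integrable_measurable_fun ip.
case: pp => p1 [p2 [m1 m2 i1 i2 pE]]; case: FF => mF F2 Fq.
have mtr : measurable_fun Omega
    ((fun x => \tr (F x)) : R3 (measurableTypeR R) -> R).
  exact: measurable_sum.
apply: (ae_le_integrable mO (measurable_funM mp mtr) _ (integrable_EFinD mO
  (integrable_EFinZ mO trace_cst (integrable_EFinD mO i1 F2))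
  (integrable_EFinZ mO trace_cst (integrable_EFinD mO Fq i2)))).
apply: (ae_mono w0) => x wx Ox /=; rewrite pE //.
have Y0 := fro_ge0 (F x); have k0 : 0 <= trace_cst := fro_ge0 (1%:M : 'M[R]_3).
have htr : `|\tr (F x)| <= trace_cst * fro (F x).
  by rewrite -[\tr _]mul1r -ddot_scalar_mx scale1r ddot_cauchy_schwarz.
rewrite normrM; apply: (@le_trans _ _ ((`|p1 x| + `|p2 x|) * (trace_cst * fro (F x)))).
  by rewrite ler_pM // ler_normD.
rewrite mulrCA -mulrDr ler_wpM2l // mulrDl lerD //.
  by have := mulr_le_sqrD `|p1 x| (fro (F x)); rewrite real_normK ?num_real.
have := young_conj q2 (lexx 1) (normr_ge0 (p2 x)) Y0 wx.
by rewrite divr1 mul1r.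
Qed.

Lemma Mq_finite_pressure p : Mq Omega q w p -> finite_pressure p.
Proof.
move=> [p1 [p2 [[L1 _] [L2 _] pE]]].
have p01 : {ae vol, forall x, 0 <= (unit_weight : R3 R -> R) x}.
  by apply/aeW => x; exact: ler01.
have mc : measurable_fun setT (conj_weight q w : R3 (measurableTypeR R) -> R).
  exact: (measurableT_comp (measurable_powR _) mw).
have c0 : {ae vol, forall x, 0 <= conj_weight q w x}.
  by apply/aeW => x; exact: powR_ge0.
have [n1 i1] := (in_Lq_integrable mO measurable_unit_weight p01 _ _).1 L1.
have [n2 i2] := (in_Lq_integrable mO mc c0 _ _).1 L2.
exists p1, p2; split; [exact: n1|exact: n2| |exact: i2|exact: pE].
apply: eq_integrable i1 => // x _ /=.
by rewrite mulr1 powR_mulrn // real_normK ?num_real.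
Qed.

(** Lets discrete pressures test the divergence constraint of the continuous problem. *)
Lemma L2_Mq r : in_Lq0 Omega 2 unit_weight r -> Mq Omega q w r.
Proof.
move=> Lr; exists r, (fun=> 0); split=> //; last by move=> x _; rewrite addr0.
split; last by rewrite Rintegral_cst // mul0r.
split; first exact: measurable_cst.
rewrite (eq_integral (fun=> 0%E)) ?integral0 // => x _.
rewrite normr0 powR0 ?mul0r // /conj_exp gt_eqF // divr_gt0 //; move: q2; lra.
Qed.

End FiniteEnergy.

(** * The continuous equation on discrete velocities *)
Lemma cvg_sumr (R : realType) (I : Type) (s : seq I) (a : I -> nat -> R)
    (l : I -> R) : (forall i, a i n @[n --> \oo] --> l i) ->
  \sum_(i <- s) a i n @[n --> \oo] --> \sum_(i <- s) l i.
Proof.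
move=> al; elim: s => [|i s IH].
  by rewrite big_nil; under eq_fun do rewrite big_nil; exact: cvg_cst.
by rewrite big_cons; under eq_fun do rewrite big_cons; exact: cvgD.
Qed.

Section TestFields.
Context {R : realType} {Omega : set (R3 R)}.
Implicit Types (w : R3 R -> R) (r : R).

Lemma entries_bounded_fro m n (F : R3 R -> 'M[R]_(m, n)) :
  (forall i j, exists C, forall x, `|F x i j| <= C) ->
  exists M, forall x, fro (F x) <= M.
Proof.
move=> HF; have [C HC] := choice (fun ij : 'I_m * 'I_n => HF ij.1 ij.2).
exists (\sum_i \sum_j C (i, j)) => x; apply: le_trans (fro_le_sum _) _.
by apply: ler_sum => i _; apply: ler_sum => j _; exact: (HC (i, j)).
Qed.

Section OneField.
Variable Phi : R3 R -> 'rV[R]_3.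
Hypothesis tP : test_field Omega Phi.

Lemma classical_gradE i j :
  (fun x => classical_grad Phi x i j) = partial (fun x => Phi x 0 i) j.
Proof. by apply/funext => x; rewrite mxE. Qed.

Lemma test_field_measurable : measurable_mx Omega Phi.
Proof.
move=> i j; rewrite (ord1 i); apply: measurable_funTS.
by apply: continuous_measurable3; exact: (test_function_continuous (tP j)).
Qed.

Lemma classical_grad_measurable : measurable_mx Omega (classical_grad Phi).
Proof.
move=> i j; rewrite classical_gradE; apply: measurable_funTS.
apply: continuous_measurable3.
exact: (test_function_partial_continuous (i := j) (tP i)).
Qed.

Lemma test_field_bounded : exists M, forall x, fro (Phi x) <= M.
Proof.
apply: entries_bounded_fro => i j; rewrite (ord1 i).
have [_ [K [cK _ K0]]] := tP j.
exact: (compact_support_bounded (test_function_continuous (tP j)) cK K0).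
Qed.

Lemma classical_grad_bounded : exists M, forall x, fro (classical_grad Phi x) <= M.
Proof.
apply: entries_bounded_fro => i j.
have [_ [K [cK _ K0]]] := tP i.
have cp := test_function_partial_continuous (i := j) (tP i).
have p0 x : ~ K x -> partial (fun y => Phi y 0 i) j x = 0.
  exact: (closed_partial_support _ (compact_closed3 cK) K0).
have [C HC] := compact_support_bounded cp cK p0.
by exists C => x; rewrite mxE; exact: HC.
Qed.

End OneField.

Lemma norm_Lqt_subrr m n r w (F : R3 R -> 'M[R]_(m, n)) : 0 < r ->
  norm_Lqt Omega r w (fun x => F x - F x) = 0.
Proof.
move=> r0; rewrite /norm_Lqt /norm_Lq.
rewrite (_ : Rintegral _ _ _ = 0) ?powR0 ?invr_eq0 ?gt_eqF //.
rewrite /Rintegral (eq_integral (fun=> 0%E)) ?integral0 // => x _.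
by rewrite subrr fro0 normr0 powR0 ?mul0r // gt_eqF.
Qed.

Hypothesis mO : measurable (Omega : set (R3 (measurableTypeR R))).

Lemma test_wfield_W1q0 w r (Phi : R3 R -> 'rV[R]_3) (tP : test_field Omega Phi) :
  measurable_fun setT (w : R3 (measurableTypeR R) -> R) ->
  {ae vol, forall x, 0 < w x} -> vol.-integrable Omega (EFin \o w) ->
  0 < r -> in_W1q0 r w (test_wfield tP).
Proof.
move=> mw w0 iw r0; split.
  have [M1 h1] := test_field_bounded tP.
  have [M2 h2] := classical_grad_bounded tP.
  split; first apply: (bounded_in_Lqt mO mw w0 iw (ltW r0) (M := M1)).
  - exact: test_field_measurable.
  - by apply/aeW => x _; exact: h1.
  apply: (bounded_in_Lqt mO mw w0 iw (ltW r0) (M := M2)).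
  - exact: classical_grad_measurable.
  - by apply/aeW => x _; exact: h2.
(* A test field is its own approximating sequence. *)
exists (fun=> Phi); split=> //=.
  by rewrite (norm_Lqt_subrr w _ r0); exact: cvg_cst.
by rewrite (norm_Lqt_subrr w _ r0); exact: cvg_cst.
Qed.

(* Weak-* convergence of the gradients lets an identity tested with smooth
   fields pass to the limit, since [T] is integrable. *)
Lemma W1inf0_ddot_eq0 (T : R3 R -> 'M[R]_3) (v : wfield Omega) :
  integrable_mx Omega T ->
  (forall Phi, test_field Omega Phi ->
    \int[vol]_(x in Omega) ddot (T x) (classical_grad Phi x) = 0) ->
  in_W1inf0 v -> \int[vol]_(x in Omega) ddot (T x) (grad v x) = 0.
Proof.
move=> iT T0 [_ [mG [_ [M GM]]] [Phi [B [tPhi PhiB _ cvgG]]]].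
have GM' : {ae vol, forall x, Omega x -> fro (grad v x) <= M}.
  by apply: (ae_mono GM) => x h Ox; apply: le_trans (ler_norm _) (h Ox).
rewrite (Rintegral_ddot mO iT mG GM').
(* The entries of [T] are the L^1 functions against which the gradients converge. *)
have I1 i j : in_Lq Omega 1 unit_weight (fun x => T x i j).
  apply/(in_Lq_integrable mO measurable_unit_weight).
    by apply/aeW => x; exact: ler01.
  split; first exact: (integrable_mx_measurable iT).
  apply: eq_integrable (integrable_norm (iT i j)) => // x _ /=.
  by rewrite mulr1 powRr1.
have L : (\sum_i \sum_j \int[vol]_(x in Omega)
      (classical_grad (Phi n) x i j * T x i j))
    @[n --> \oo] -->
    \sum_i \sum_j \int[vol]_(x in Omega) (grad v x i j * T x i j).
  by apply: cvg_sumr => i; apply: cvg_sumr => j; exact: cvgG.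
have Z n : \sum_i \sum_j \int[vol]_(x in Omega)
    (classical_grad (Phi n) x i j * T x i j) = 0.
  rewrite -(Rintegral_ddot mO iT (M := B)) ?T0 //.
  - exact: classical_grad_measurable.
  - by apply/aeW => x _; have [] := PhiB n x.
move: L; under eq_fun do rewrite Z; move=> L.
by apply/esym/(cvg_unique _ (cvg_cst _) L).
Qed.

End TestFields.

(** Real numbers only, so that the constant visibly precedes the errors [a2], [aq], [n2], [N]. In
    use [K] bounds the sum of the two weighted energies and [M] the whole left-hand side. *)
Lemma free_scale_bound (R : realType) (mu c C K M q : R) :
  2 <= q -> 0 < mu -> 0 < c -> 0 <= C -> 0 <= K -> 0 <= M ->
  exists2 Ct : R, 0 < Ct & forall a2 aq n2 N,
    0 <= a2 -> 0 <= aq -> 0 <= n2 -> 0 <= N ->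
    (forall s, 0 < s ->
      mu * a2 + c * aq <= 2 * mu * n2 + C * s ^+ 2 * (K + 2 * N `^ q / s `^ q)) ->
    a2 + aq <= M -> a2 + aq <= Ct * (n2 + N `^ (q / (q - 1))).
Proof.
move=> q2 mu0 c0 C0 K0 M0; pose m := Num.min mu c.
have m0 : 0 < m by rewrite lt_min mu0 c0.
have CK0 : 0 <= C * (K + 2) by rewrite mulr_ge0 // addr_ge0.
pose L := 2 * mu + C * (K + 2).
have L0 : 0 < L by rewrite ltr_wpDr // mulr_gt0.
(* L / m serves N <= 1, [M] serves N > 1, where the bracket on the right is at least 1, and the
   final 1 makes the constant positive. *)
exists (L / m + M + 1) => [|a2 aq n2 N a20 aq0 n20 N0 H aM].
  by rewrite ltr_wpDl // addr_ge0 // divr_ge0 // ltW.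
have ma : m * (a2 + aq) <= mu * a2 + c * aq.
  by rewrite mulrDr lerD // ler_wpM2r // ge_min lexx ?orbT.
set P := N `^ (q / (q - 1)); have P0 : 0 <= P by exact: powR_ge0.
have Lm0 : 0 <= L / m by rewrite divr_ge0 // ltW.
have step : m * (a2 + aq) <= L * (n2 + P) -> a2 + aq <= (L / m + M + 1) * (n2 + P).
  rewrite -ler_pdivlMl // => h; apply: le_trans h _.
  rewrite mulrA [m^-1 * L]mulrC ler_wpM2r ?addr_ge0 //.
  by rewrite -addrA lerDl addr_ge0.
move: N0; rewrite le_eqVlt => /predU1P[N0|N0].
  (* For N = 0 the scale s = N is not allowed; the quotient vanishes instead, and [s] is taken
     arbitrarily small. *)
  apply: step; apply: (@le_trans _ _ (2 * mu * n2)); last first.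
    apply: ler_pM => //; first by rewrite mulr_ge0 // ltW.
      by rewrite /L lerDl.
    by rewrite lerDl.
  apply/ler_addgt0Pr => e e0; apply: le_trans ma _.
  (* C K may be zero; adding 1 keeps the division meaningful. *)
  have D0 : 0 < C * K + 1 by rewrite ltr_wpDl // mulr_ge0.
  pose s := Num.sqrt (e / (C * K + 1)).
  have s0 : 0 < s by rewrite sqrtr_gt0 divr_gt0.
  apply: le_trans (H s s0) _; rewrite lerD2l -N0 powR0; last by rewrite gt_eqF //; lra.
  rewrite mulr0 mul0r addr0 sqr_sqrtr; last by rewrite divr_ge0 // ltW.
  rewrite mulrAC mulrA ler_pdivrMr // mulrC ler_wpM2l ?(ltW e0) //.
  by rewrite lerDl.
have [N1|N1] := leP N 1.
  apply: step; apply: le_trans ma _; apply: le_trans (H N N0) _.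
  have Nq : 0 < N `^ q by rewrite powR_gt0.
  rewrite mulfK ?gt_eqF //.
  have NP : N ^+ 2 <= P.
    rewrite -powR_mulrn ?(ltW N0) //.
    have /ger_powR h : 0 < N <= 1 by rewrite N0.
    apply: h; rewrite ler_pdivrMr; lra.
  have h1 : C * N ^+ 2 * (K + 2) <= C * (K + 2) * P.
    by rewrite mulrAC ler_wpM2l.
  have h2 : 0 <= C * (K + 2) * n2 by rewrite mulr_ge0.
  have h3 : 0 <= 2 * mu * P by rewrite !mulr_ge0 // ltW.
  rewrite /L; lra.
have P1 : 1 <= P.
  rewrite -(powRr0 N) ler_powR ?(ltW N1) // divr_ge0 //; lra.
apply: le_trans aM _.
apply: (@le_trans _ _ ((L / m + M + 1) * 1)).
  by rewrite mulr1; lra.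
by apply: ler_wpM2l; [rewrite !addr_ge0|rewrite ler_wpDl].
Qed.

Section WeakForm.
Context {R : realType} {Omega : set (R3 R)}.
Hypothesis mO : measurable (Omega : set (R3 (measurableTypeR R))).
Hypothesis iO : forall k : R, vol.-integrable Omega (EFin \o cst k).
Variable w : R3 R -> R.
Hypothesis mw : measurable_fun setT (w : R3 (measurableTypeR R) -> R).
Hypothesis w0 : {ae vol, forall x, 0 < w x}.
Hypothesis iw : vol.-integrable Omega (EFin \o w).
Variables mu q : R.
Hypothesis mu0 : 0 < mu.
Hypothesis q2 : 2 <= q.
Implicit Types (F G A B E : R3 R -> 'M[R]_3) (p : R3 R -> R) (u v : wfield Omega).
Local Notation S := (stress mu q w).
Local Notation intg f := (vol.-integrable Omega (EFin \o f)).
Local Notation finite_energy F := (@finite_energy _ Omega w q F).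
Local Notation finite_pressure p := (@finite_pressure _ Omega w q p).

Lemma in_sum_Lqt_integrable f : in_sum_Lqt Omega q w f -> integrable_mx Omega f.
Proof.
move=> [F1 [F2 [L1 L2 fE]]].
have p01 : {ae vol, forall x, 0 <= (unit_weight : R3 R -> R) x}.
  by apply/aeW => x; exact: ler01.
have mc : measurable_fun setT (conj_weight q w : R3 (measurableTypeR R) -> R).
  exact: (measurableT_comp (measurable_powR _) mw).
have c0 : {ae vol, forall x, 0 <= conj_weight q w x}.
  by apply/aeW => x; exact: powR_ge0.
have [n1 [_ i1]] : measurable_mx Omega F1 /\ _ :=
  conj L1.1 ((in_Lq_integrable mO measurable_unit_weight p01 _ _).1 L1.2).
have [n2 [_ i2]] : measurable_mx Omega F2 /\ _ :=
  conj L2.1 ((in_Lq_integrable mO mc c0 _ _).1 L2.2).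
have I1 : integrable_mx Omega F1.
  apply: (integrable_mx_of_fro mO n1 _ (integrable_EFinD mO i1 (iO 1))).
  apply/aeW => x _ /=; have := normr_le_sqrD1 (fro (F1 x)).
  by rewrite mulr1 powR_mulrn // ger0_norm ?fro_ge0.
have I2 : integrable_mx Omega F2.
  apply: (integrable_mx_of_fro mO n2 _ (integrable_EFinD mO iw i2)).
  apply: (ae_mono w0) => x wx _.
  have := young_conj q2 (lexx 1) (fro_ge0 (F2 x)) ler01 wx.
  by rewrite !mulr1 powR1 divr1 mulr1 mul1r ger0_norm ?fro_ge0.
move=> i j; apply: eq_integrable (integrable_EFinD mO (I1 i j) (I2 i j)) => //.
by move=> x xO /=; rewrite fE ?mxE // -in_setE.
Qed.

Lemma W1inf0_bounded v : in_W1inf0 v -> measurable_mx Omega (grad v) /\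
  exists M, {ae vol, forall x, Omega x -> fro (grad v x) <= M}.
Proof.
move=> [_ [mG [_ [M GM]]] _]; split=> //; exists M.
by apply: (ae_mono GM) => x h Ox; apply: le_trans (ler_norm _) (h Ox).
Qed.

Lemma W1inf0_finite_energy v : in_W1inf0 v -> finite_energy (eps v).
Proof.
move=> /W1inf0_bounded[mG [M GM]].
apply: (bounded_finite_energy mO iO mw w0 iw q2 (measurable_eps mG) (M := M)).
by apply: (ae_mono GM) => x h Ox; apply: le_trans (fro_eps_le v x) (h Ox).
Qed.

Lemma Xq_finite_energy v : Xq Omega q w v -> finite_energy (eps v).
Proof.
move=> [[[_ G2] _] [[_ Gq] _]].
have mG : measurable_mx Omega (grad v) by case: G2.
apply: (finite_energy_le mO mw w0 q2 (measurable_eps mG) (fro_eps_le v)).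
exact: (in_Lqt_finite_energy mO mw w0 G2 Gq).
Qed.

Lemma ddot_stress_eps u v x :
  ddot (S x (eps u x)) (eps v x) = ddot (S x (eps u x)) (grad v x).
Proof. by rewrite /stress ddotZl [RHS]ddotZl ddot_eps_grad. Qed.

(** The whole equation as one matrix field paired with the gradient of the test field, the pressure
    acting through the identity matrix. The passage to weak-* limits needs this form. *)
Definition residual f u p : R3 R -> 'M[R]_3 :=
  fun x => S x (eps u x) - p x *: 1%:M - f x.

Lemma integrable_residual f u p : integrable_mx Omega f ->
  finite_energy (eps u) -> finite_pressure p ->
  integrable_mx Omega (residual f u p).
Proof.
move=> i_f fu fp; apply: integrable_mxB => //; apply: integrable_mxB => //.
  exact: (integrable_stress mO iO mw w0 iw mu0 q2 fu).
move=> i j; have ip := integrable_pressure mO iO w0 iw q2 fp.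
under eq_fun do rewrite mxE mulrC; exact: integrable_EFinZ.
Qed.

Lemma Rintegral_residual f u p v M : integrable_mx Omega f ->
  finite_energy (eps u) -> finite_pressure p -> measurable_mx Omega (grad v) ->
  {ae vol, forall x, Omega x -> fro (grad v x) <= M} ->
  \int[vol]_(x in Omega) ddot (residual f u p x) (grad v x) =
  \int[vol]_(x in Omega) ddot (S x (eps u x)) (eps v x)
  - \int[vol]_(x in Omega) (p x * div v x)
  - \int[vol]_(x in Omega) ddot (f x) (grad v x).
Proof.
move=> i_f fu fp mG GM.
have fv : finite_energy (eps v).
  apply: (bounded_finite_energy mO iO mw w0 iw q2 (measurable_eps mG) (M := M)).
  by apply: (ae_mono GM) => x h Ox; apply: le_trans (fro_eps_le v x) (h Ox).
have iS := integrable_stress_ddot mO mw w0 mu0 q2 fu fv.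
have iP : intg (fun x => p x * div v x).
  have := integrable_pressure_trace mO iO w0 iw q2 fp fv.
  by apply: eq_integrable => // x _ /=; rewrite div_eps.
have iF := integrable_ddot mO i_f mG GM.
rewrite -(RintegralB mO iS iP) -(RintegralB mO (integrable_EFinB mO iS iP) iF).
apply: eq_Rintegral => x _.
by rewrite /residual !ddotBl ddot_stress_eps ddot_scalar_mx.
Qed.

(** Membership of [v] in [Xq] is not claimed: only the equation passes from test fields, which do
    lie in [Xq], to their weak-* limit. *)
Lemma mixed_solution_W1inf0 f u p v : integrable_mx Omega f ->
  mixed_solution mu q w f (Xq Omega q w) (Mq Omega q w) u p -> in_W1inf0 v ->
  \int[vol]_(x in Omega) ddot (S x (eps u x)) (eps v x)
  - \int[vol]_(x in Omega) (p x * div v x)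
  = \int[vol]_(x in Omega) ddot (f x) (grad v x).
Proof.
move=> i_f [Xu Mp eqn _] hv.
have fu := Xq_finite_energy Xu.
have fp := Mq_finite_pressure mO mw Mp.
have [mG [M GM]] := W1inf0_bounded hv.
apply/eqP; rewrite -subr_eq0; apply/eqP.
rewrite -(Rintegral_residual i_f fu fp mG GM).
apply: (W1inf0_ddot_eq0 mO (integrable_residual i_f fu fp) _ hv) => Phi tP.
have [B hB] := classical_grad_bounded tP.
have hB' : {ae vol, forall x, Omega x -> fro (grad (test_wfield tP) x) <= B}.
  by apply/aeW => x _; exact: hB.
have mB : measurable_mx Omega (grad (test_wfield tP)).
  exact: classical_grad_measurable.
have XT : Xq Omega q w (test_wfield tP).
  have iu : vol.-integrable Omega (EFin \o unit_weight) := iO 1.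
  split; first exact: (test_wfield_W1q0 mO tP measurable_unit_weight
    unit_weight_gt0 iu (ltr0n R 2)).
  exact: (test_wfield_W1q0 mO tP mw w0 iw (lt_le_trans (ltr0n R 2) q2)).
have E := Rintegral_residual i_f fu fp mB hB'.
by rewrite (eqn _ XT) subrr in E.
Qed.

End WeakForm.

(** * Energy and error estimates *)
Section ErrorEstimate.
Context {R : realType} {Omega : set (R3 R)}.
Hypothesis mO : measurable (Omega : set (R3 (measurableTypeR R))).
Hypothesis iO : forall k : R, vol.-integrable Omega (EFin \o cst k).
Variable w : R3 R -> R.
Hypothesis mw : measurable_fun setT (w : R3 (measurableTypeR R) -> R).
Hypothesis w0 : {ae vol, forall x, 0 < w x}.
Hypothesis iw : vol.-integrable Omega (EFin \o w).
Variables mu q : R.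
Hypothesis mu0 : 0 < mu.
Hypothesis q2 : 2 <= q.
Implicit Types (F G A B E V : R3 R -> 'M[R]_3) (p : R3 R -> R) (u v : wfield Omega).
Local Notation S := (stress mu q w).
Local Notation intg f := (vol.-integrable Omega (EFin \o f)).
Local Notation finite_energy F := (@finite_energy _ Omega w q F).
Local Notation finite_pressure p := (@finite_pressure _ Omega w q p).

(** [A] and [p] belong to the reference solution, which stands in for the forcing; the bound is
    chosen before [B], the strain of any exact or discrete solution. *)
Lemma energy_bound A p : finite_energy A -> finite_pressure p ->
  exists2 K, 0 <= K & forall B, finite_energy B ->
    \int[vol]_(x in Omega) ddot (S x (B x)) (B x) =
      \int[vol]_(x in Omega) ddot (S x (A x)) (B x)
      - \int[vol]_(x in Omega) (p x * \tr (B x)) ->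
    mu * \int[vol]_(x in Omega) fro (B x) ^+ 2
    + \int[vol]_(x in Omega) (w x * fro (B x) `^ q) <= K.
Proof.
move=> fA fp; have [p1 [p2 [m1 m2 i1 i2 pE]]] := fp.
have [mA A2 Aq] := fA.
pose k : R := trace_cst.
have iR := integrable_EFinD mO (integrable_EFinD mO (integrable_EFinD mO
  (integrable_EFinZ mO (2 * mu) A2) (integrable_EFinZ mO 8 Aq))
  (integrable_EFinZ mO (k ^+ 2 / (2 * mu)) i1))
  (integrable_EFinZ mO (k * (1 + 2 * k)) i2).
set r := (X in intg X) in iR.
(* The absolute value makes the bound nonnegative at once. *)
exists `|\int[vol]_(x in Omega) r x| => // B fB eqB.
have [mB B2 Bq] := fB.
have iBB := integrable_stress_ddot mO mw w0 mu0 q2 fB fB.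
have iAB := integrable_stress_ddot mO mw w0 mu0 q2 fA fB.
have iP := integrable_pressure_trace mO iO w0 iw q2 fp fB.
have iL := integrable_EFinB mO iBB iAB.
have iLP := integrable_EFinD mO iL iP.
have iB2 := integrable_EFinZ mO mu B2.
apply: le_trans (ler_norm _).
(* By [eqB] the added terms integrate to zero; they give the integrand the form of
   [energy_pointwise]. *)
have -> : \int[vol]_(x in Omega) r x =
    \int[vol]_(x in Omega) (ddot (S x (B x)) (B x) - ddot (S x (A x)) (B x)
      + p x * \tr (B x) + r x).
  rewrite (RintegralD mO iLP iR) (RintegralD mO iL iP) (RintegralB mO iBB iAB).
  by rewrite eqB; ring.
rewrite -(RintegralZl mu mO B2) -(RintegralD mO iB2 Bq).
apply: (ae_le_Rintegral mO (integrable_EFinD mO iB2 Bq)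
  (integrable_EFinD mO iLP iR)).
apply: (ae_mono w0) => x wx Ox.
have := energy_pointwise (A x) (B x) (p1 x) (p2 x) q2 mu0 wx.
by rewrite -(pE x Ox).
Qed.

(** [V] has two faces: in the orthogonality hypothesis it is the discrete strain of Uh - uh, in the
    pointwise estimate it is A - B - E. *)
Lemma error_integral (n : nat) A B E V (s : R) :
  finite_energy A -> finite_energy B -> finite_energy E ->
  q - 2 <= n%:R -> 0 < s ->
  V = (fun x => A x - B x - E x) ->
  \int[vol]_(x in Omega) ddot (S x (A x)) (V x)
    - \int[vol]_(x in Omega) ddot (S x (B x)) (V x)
    - 2 * mu * \int[vol]_(x in Omega) ddot (E x) (V x) = 0 ->
  mu * \int[vol]_(x in Omega) fro (A x - B x) ^+ 2
  + (2 * 2 `^ (q - 2))^-1 * \int[vol]_(x in Omega) (w x * fro (A x - B x) `^ q)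
  <= 2 * mu * \int[vol]_(x in Omega) fro (E x) ^+ 2
     + 2 * n.+1%:R ^+ 2 * s ^+ 2 *
       (\int[vol]_(x in Omega) (w x * fro (A x) `^ q)
        + \int[vol]_(x in Omega) (w x * fro (B x) `^ q)
        + 2 * \int[vol]_(x in Omega) (w x * fro (E x) `^ q) / s `^ q).
Proof.
move=> fA fB fE qn s0 VE hV.
have fAB := finite_energyB mO mw w0 q2 fA fB.
have fV : finite_energy V by rewrite VE; exact: (finite_energyB mO mw w0 q2 fAB fE).
have [_ D2 Dq] := fAB; have [_ E2 Eq] := fE.
have [_ _ Aq] := fA; have [_ _ Bq] := fB.
have iAV := integrable_stress_ddot mO mw w0 mu0 q2 fA fV.
have iBV := integrable_stress_ddot mO mw w0 mu0 q2 fB fV.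
have iEV := integrable_energy_ddot mO fE fV.
set c := (2 * _)^-1; set C := 2 * _ ^+ 2 * _.
have iD := integrable_EFinD mO (integrable_EFinZ mO mu D2) (integrable_EFinZ mO c Dq).
have i1 := integrable_EFinB mO iAV iBV.
have i2 := integrable_EFinZ mO (2 * mu) iEV.
have i3 := integrable_EFinB mO i1 i2.
have i4 := integrable_EFinZ mO (2 * mu) E2.
have i5 := integrable_EFinD mO Aq Bq.
have i6 := integrable_EFinZ mO (2 / s `^ q) Eq.
have i7 := integrable_EFinZ mO C (integrable_EFinD mO i5 i6).
have i34 := integrable_EFinD mO i3 i4.
have -> : mu * \int[vol]_(x in Omega) fro (A x - B x) ^+ 2
    + c * \int[vol]_(x in Omega) (w x * fro (A x - B x) `^ q) =
    \int[vol]_(x in Omega)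
      (mu * fro (A x - B x) ^+ 2 + c * (w x * fro (A x - B x) `^ q)).
  rewrite (RintegralD mO (integrable_EFinZ mO mu D2) (integrable_EFinZ mO c Dq)).
  by rewrite (RintegralZl mu mO D2) (RintegralZl c mO Dq).
apply: (le_trans (ae_le_Rintegral mO iD (integrable_EFinD mO i34 i7) _)).
  apply: (ae_mono w0) => x wx _.
  have := error_pointwise (A x) (B x) (E x) (ltW mu0) q2 qn (ltW wx) s0.
  have <- : V x = A x - B x - E x by rewrite VE.
  rewrite -/c -/C /stress !ddotBl ddotZl [ddot (_ *: E x) _]ddotZl.
  by rewrite [2 * (w x * _) / _]mulrAC.
rewrite (RintegralD mO i34 i7) (RintegralD mO i3 i4) (RintegralB mO i1 i2).
rewrite (RintegralB mO iAV iBV) (RintegralZl _ mO iEV) hV add0r.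
rewrite (RintegralZl _ mO E2) (RintegralZl C mO (integrable_EFinD mO i5 i6)).
rewrite (RintegralD mO i5 i6) (RintegralD mO Aq Bq) (RintegralZl _ mO Eq).
by rewrite [2 * Rintegral _ _ _ / _]mulrAC.
Qed.

(** Allows testing with [Uh] and [uh] one at a time and subtracting, instead of building a [wfield]
    for their difference. *)
Lemma Rintegral_ddotBr G1 G2 (H : R3 R -> 'M[R]_3) :
  intg (fun x => ddot (H x) (G1 x)) -> intg (fun x => ddot (H x) (G2 x)) ->
  \int[vol]_(x in Omega) ddot (H x) (G1 x - G2 x) =
  \int[vol]_(x in Omega) ddot (H x) (G1 x)
  - \int[vol]_(x in Omega) ddot (H x) (G2 x).
Proof.
move=> h1 h2; rewrite -(RintegralB mO h1 h2).
by apply: eq_Rintegral => x _; rewrite ddotBr.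
Qed.

End ErrorEstimate.

(** * The quasi-best approximation estimate *)

Theorem theorem6p2 (R : realType) (Omega : set (R3 R)) (mu q : R)
    (w : R3 R -> R) (f : R3 R -> 'M[R]_3)
    (H : set R) (Th : R -> set (4.-tuple (R3 R)))
    (Xh : R -> set (wfield Omega)) (Mh : R -> set (R3 R -> R))
    (hOmega : convex_polyhedron Omega) (hmu : 0 < mu) (hq : 2 <= q)
    (hw : muckenhoupt (q / 2) w) (hf : in_sum_Lqt Omega q w f)
    (hfe : fe_family H Th Xh Mh) :
  exists2 C : R, 0 < C &
    forall (u : wfield Omega) (p : R3 R -> R),
    mixed_solution mu q w f (Xq Omega q w) (Mq Omega q w) u p ->
    forall h : R, H h ->
    forall (uh : wfield Omega) (ph : R3 R -> R),
    mixed_solution mu q w f (Xh h) (Mh h) uh ph ->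
    forall (Uh : wfield Omega) (Ph : R3 R -> R),
    stokes_projection mu (Xh h) (Mh h) u p Uh Ph ->
    norm_Lqt Omega 2 unit_weight (fun x => eps u x - eps uh x) ^+ 2
    + norm_Lqt Omega q w (fun x => eps u x - eps uh x) `^ q
    <= C * (norm_Lqt Omega 2 unit_weight (fun x => eps u x - eps Uh x) ^+ 2
            + norm_Lqt Omega q w (fun x => eps u x - eps Uh x)
                `^ (q / (q - 1))).
Proof.
have le_double (a b z : R) : a <= z -> b <= z -> a + b <= 2 * z by lra.
have le_quadruple (a b z : R) : a <= z -> b <= z -> 2 * a + 2 * b <= 4 * z by lra.
have [mw w0 _] := hw.1.
have mO := polyhedron_measurable hOmega.
have iO := polyhedron_integrable_cst hOmega.
have iw := weight_integrable hOmega hw.1.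
have i_f := in_sum_Lqt_integrable mO iO mw w0 iw hq hf.
(* The reference solution is chosen before the constant; if there is none, the claim is vacuous. *)
have [[u0 [p0 sol0]]|nosol] := pselect (exists u p,
  mixed_solution mu q w f (Xq Omega q w) (Mq Omega q w) u p); last first.
  by exists 1 => // u p sol; case: nosol; exists u, p.
have [X0 M0 eqn0 _] := sol0.
have fu0 := Xq_finite_energy mO mw w0 hq X0.
have fp0 := Mq_finite_pressure mO mw M0.
have [K K0 HK] := energy_bound mO iO mw w0 iw hmu hq fu0 fp0.
have [n qn] : exists n : nat, q - 2 <= n%:R.
  by exists (Num.bound (q - 2)); rewrite ltW // archi_boundP // subr_ge0.
have c0 : 0 < (2 * 2 `^ (q - 2))^-1 :> R by rewrite invr_gt0 mulr_gt0 ?powR_gt0.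
have C0 : 0 <= 2 * n.+1%:R ^+ 2 :> R by rewrite mulr_ge0 ?sqr_ge0.
have K20 : 0 <= 2 * K by rewrite mulr_ge0.
(* The two summands bound the squared L^2 error and the q-th power of the weighted error by the
   energies of [u] and [uh], each controlled by [K]. *)
have M20 : 0 <= 4 * (K / mu) + 2 `^ q * (2 * K).
  by rewrite addr_ge0 ?mulr_ge0 ?powR_ge0 ?invr_ge0 ?(ltW hmu).
have [Ct Ct0 bound] := free_scale_bound hq hmu c0 C0 K20 M20.
exists Ct => // u p sol h Hh uh ph solh Uh Ph st.
have [Xu Mp eqnu divu] := sol; have [Xuh Mph eqnh divh] := solh.
have [XUh MPh eqnP divP] := st.
have W v : Xh h v -> in_W1inf0 v by exact: fe_velocity_conforming hfe h Hh v.
have MhMq r : Mh h r -> Mq Omega q w r.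
  by move=> Mr; apply: (L2_Mq mO w hq); have [] := fe_pressure_conforming hfe Hh Mr.
have fA := Xq_finite_energy mO mw w0 hq Xu.
have fB := W1inf0_finite_energy mO iO mw w0 iw hq (W _ Xuh).
have fU := W1inf0_finite_energy mO iO mw w0 iw hq (W _ XUh).
have fE := finite_energyB mO mw w0 hq fA fU.
have fAB := finite_energyB mO mw w0 hq fA fB.
have fV := finite_energyB mO mw w0 hq fAB fE.
have fp := Mq_finite_pressure mO mw Mp.
have fph r : Mh h r -> @finite_pressure _ Omega w q r.
  by move=> /MhMq; exact: Mq_finite_pressure.
have iPdiv r (v : wfield Omega) : @finite_pressure _ Omega w q r ->
    @finite_energy _ Omega w q (eps v) ->
    vol.-integrable Omega (EFin \o (fun x => r x * div v x)).
  move=> fr fv; have := integrable_pressure_trace mO iO w0 iw hq fr fv.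
  by apply: eq_integrable => // x _ /=; rewrite div_eps.
have swap r (v : wfield Omega) : \int[vol]_(x in Omega) (r x * div v x) =
    \int[vol]_(x in Omega) (div v x * r x).
  by apply: eq_Rintegral => x _; rewrite mulrC.
have trace r (v : wfield Omega) : \int[vol]_(x in Omega) (r x * div v x) =
    \int[vol]_(x in Omega) (r x * \tr (eps v x)).
  by apply: eq_Rintegral => x _; rewrite div_eps.
have EA : mu * \int[vol]_(x in Omega) fro (eps u x) ^+ 2
    + \int[vol]_(x in Omega) (w x * fro (eps u x) `^ q) <= K.
  apply: (HK _ fA); rewrite -trace (eqn0 _ Xu) -(eqnu _ Xu) swap (divu _ Mp).
  by rewrite subr0.
(* Since [uh] is only discretely divergence free, its own pressure drops but the pairing with [p0]
   survives; hence the pressure in [energy_bound]. *)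
have EB : mu * \int[vol]_(x in Omega) fro (eps uh x) ^+ 2
    + \int[vol]_(x in Omega) (w x * fro (eps uh x) `^ q) <= K.
  apply: (HK _ fB); rewrite -trace.
  rewrite (mixed_solution_W1inf0 mO iO mw w0 iw hmu hq i_f sol0 (W _ Xuh)).
  by rewrite -(eqnh _ Xuh) swap (divh _ Mph) subr0.
(* The projection constrains the divergence of u - Uh only; that of [u] vanishes against [Mh]
   because [Mh] lies in [Mq]. *)
have divU r : Mh h r -> \int[vol]_(x in Omega) (r x * div Uh x) = 0.
  move=> Mr; have := divP _ Mr.
  have -> : \int[vol]_(x in Omega) ((div u x - div Uh x) * r x) =
      \int[vol]_(x in Omega) (r x * div u x - r x * div Uh x).
    by apply: eq_Rintegral => x _; rewrite mulrBl !(mulrC _ (r x)).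
  rewrite (RintegralB mO (iPdiv _ _ (fph _ Mr) fA) (iPdiv _ _ (fph _ Mr) fU)).
  rewrite [X in X - _]swap (divu _ (MhMq _ Mr)) sub0r => /eqP.
  by rewrite oppr_eq0 => /eqP.
have galerkin (v : wfield Omega) : Xh h v -> @finite_energy _ Omega w q (eps v) ->
    (forall r, Mh h r -> \int[vol]_(x in Omega) (r x * div v x) = 0) ->
    \int[vol]_(x in Omega) ddot (stress mu q w x (eps u x)) (eps v x)
    - \int[vol]_(x in Omega) ddot (stress mu q w x (eps uh x)) (eps v x)
    - 2 * mu * \int[vol]_(x in Omega) ddot (eps u x - eps Uh x) (eps v x) = 0.
  move=> Xv fv dv.
  (* The stress difference and the viscous term of the projection both equal the pairing of [p] with
     the divergence of [v], so they cancel. *)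
  have e1 := mixed_solution_W1inf0 mO iO mw w0 iw hmu hq i_f sol (W _ Xv).
  have e2 := eqnh _ Xv; have e3 := eqnP _ Xv.
  have e4 : \int[vol]_(x in Omega) ((p x - Ph x) * div v x) =
      \int[vol]_(x in Omega) (p x * div v x).
    rewrite -[RHS]subr0 -(dv _ MPh).
    rewrite -(RintegralB mO (iPdiv _ _ fp fv) (iPdiv _ _ (fph _ MPh) fv)).
    by apply: eq_Rintegral => x _; rewrite mulrBl.
  rewrite (dv _ Mph) subr0 in e2; rewrite e4 in e3.
  by rewrite e2 -e1 opprB addrCA subrr addr0 -opprB e3 oppr0.
have VE : (fun x => eps Uh x - eps uh x) =
    (fun x => eps u x - eps uh x - (eps u x - eps Uh x)).
  by apply/funext => x; rewrite opprB [RHS]addrC addrA subrK.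
have hV : \int[vol]_(x in Omega) ddot (stress mu q w x (eps u x)) (eps Uh x - eps uh x)
    - \int[vol]_(x in Omega) ddot (stress mu q w x (eps uh x)) (eps Uh x - eps uh x)
    - 2 * mu * \int[vol]_(x in Omega)
        ddot (eps u x - eps Uh x) (eps Uh x - eps uh x) = 0.
  rewrite (Rintegral_ddotBr mO (integrable_stress_ddot mO mw w0 hmu hq fA fU)
    (integrable_stress_ddot mO mw w0 hmu hq fA fB)).
  rewrite (Rintegral_ddotBr mO (integrable_stress_ddot mO mw w0 hmu hq fB fU)
    (integrable_stress_ddot mO mw w0 hmu hq fB fB)).
  rewrite (Rintegral_ddotBr mO (integrable_energy_ddot mO fE fU)
    (integrable_energy_ddot mO fE fB)).
  have sub0 (a1 a2 b1 b2 e1 e2 : R) : a1 - b1 - 2 * mu * e1 = 0 ->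
      a2 - b2 - 2 * mu * e2 = 0 -> a1 - a2 - (b1 - b2) - 2 * mu * (e1 - e2) = 0.
    move=> h1 h2; transitivity (a1 - b1 - 2 * mu * e1 - (a2 - b2 - 2 * mu * e2)).
      by ring.
    by rewrite h1 h2 subrr.
  have divuh r : Mh h r -> \int[vol]_(x in Omega) (r x * div uh x) = 0.
    by move=> Mr; rewrite swap; exact: divh.
  exact: (sub0 _ _ _ _ _ _ (galerkin _ XUh fU divU) (galerkin _ Xuh fB divuh)).
have sq := norm_sqr_energy mO mw w0; have pw := norm_powR_energy mO mw w0 hq.
(* Three of the four terms become integrals. The weighted projection error remains a norm, since it
   enters with the exponent q / (q - 1). *)
have subst3 (a a' b b' c c' t k : R) : a = a' -> b = b' -> c = c' ->
    a' + b' <= k * (c' + t) -> a + b <= k * (c + t) by move=> -> -> ->.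
apply: (subst3 _ _ _ _ _ _ _ _ (sq _ _ fAB) (pw _ fAB) (sq _ _ fE)).
have [_ A2 Aq] := fA; have [_ B2 Bq] := fB.
have [_ D2 Dq] := fAB.
have ge0 (g : R3 R -> R) : vol.-integrable Omega (EFin \o g) ->
    {ae vol, forall x, Omega x -> 0 <= g x} -> 0 <= \int[vol]_(x in Omega) g x.
  move=> ig g0; have := ae_le_Rintegral mO (iO 0) ig g0.
  by rewrite Rintegral_cst // mul0r.
have sq0 F : @finite_energy _ Omega w q F -> 0 <= \int[vol]_(x in Omega) fro (F x) ^+ 2.
  by move=> [_ F2 _]; apply: (ge0 _ F2); apply/aeW => x _; exact: sqr_ge0.
have pw0 F : @finite_energy _ Omega w q F ->
    0 <= \int[vol]_(x in Omega) (w x * fro (F x) `^ q).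
  move=> [_ _ Fq]; apply: (ge0 _ Fq); apply: (ae_mono w0) => x wx _.
  by rewrite mulr_ge0 ?powR_ge0 ?ltW.
have bA2 : \int[vol]_(x in Omega) fro (eps u x) ^+ 2 <= K / mu.
  rewrite ler_pdivlMr // mulrC; apply: le_trans EA.
  by rewrite lerDl pw0.
have bB2 : \int[vol]_(x in Omega) fro (eps uh x) ^+ 2 <= K / mu.
  rewrite ler_pdivlMr // mulrC; apply: le_trans EB.
  by rewrite lerDl pw0.
have bAq : \int[vol]_(x in Omega) (w x * fro (eps u x) `^ q) <= K.
  apply: le_trans EA; rewrite lerDr mulr_ge0 ?(ltW hmu) //; exact: sq0.
have bBq : \int[vol]_(x in Omega) (w x * fro (eps uh x) `^ q) <= K.
  apply: le_trans EB; rewrite lerDr mulr_ge0 ?(ltW hmu) //; exact: sq0.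
have N0 : 0 <= norm_Lqt Omega q w (fun x => eps u x - eps Uh x).
  exact: powR_ge0.
apply: (bound _ _ _ _ (sq0 _ fAB) (pw0 _ fAB) (sq0 _ fE) N0).
  move=> s s0; have := error_integral mO mw w0 hmu hq fA fB fE qn s0 VE hV.
  move=> /le_trans; apply.
  rewrite lerD2l (ler_wpM2l (mulr_ge0 C0 (sqr_ge0 s))) //.
  have le_of_eq (x y : R) : y = x -> 2 * x / s `^ q <= 2 * y / s `^ q by move=> ->.
  apply: lerD; last exact: le_of_eq (pw _ fE).
  exact: le_double bAq bBq.
apply: lerD.
  have h1 := ae_le_Rintegral mO D2 (integrable_EFinD mO (integrable_EFinZ mO 2 A2)
    (integrable_EFinZ mO 2 B2)).
  apply: le_trans (h1 _) _.
    apply/aeW => x _; apply: le_trans (sqrrD_le2 _ _).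
    by rewrite ler_pXn2r ?nnegrE ?addr_ge0 ?fro_ge0 // fro_sub.
  rewrite (RintegralD mO (integrable_EFinZ mO 2 A2) (integrable_EFinZ mO 2 B2)).
  rewrite (RintegralZl 2 mO A2) (RintegralZl 2 mO B2).
  exact: le_quadruple bA2 bB2.
have q0 : 0 <= q by exact: le_trans hq.
have h1 := ae_le_Rintegral mO Dq (integrable_EFinZ mO (2 `^ q) (integrable_EFinD mO Aq Bq)).
apply: le_trans (h1 _) _.
  apply: (ae_mono w0) => x wx _; rewrite -mulrDr mulrCA ler_wpM2l ?(ltW wx) //.
  apply: le_trans (powRD_le q0 (fro_ge0 _) (fro_ge0 _)).
  by rewrite ge0_ler_powR // ?nnegrE ?addr_ge0 ?fro_ge0 // fro_sub.
rewrite (RintegralZl (2 `^ q) mO (integrable_EFinD mO Aq Bq)).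
rewrite (RintegralD mO Aq Bq); apply: (ler_wpM2l (powR_ge0 _ _)).
exact: le_double bAq bBq.
Qed.
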